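(* Let $r$ be a prime and $p$ a prime with $p\ne r$. Let $I$ be the proportion of monic degree-$r$ polynomials in $\mathbb{Z}_p[x]$ that are irreducible. Then $$I=\frac{(p^r-p)\bigl(1-p^{-(r+1)/2}\bigr)+r(p-1)\bigl(1-p^{-(r+1)(r-1)/2}\bigr)}{r\,p^r\bigl(1-p^{-r(r+1)/2+1}\bigr)\bigl(1-p^{-(r+1)/2}\bigr)}.$$
   Context: Monic degree-$r$ polynomials $x^r+c_{r-1}x^{r-1}+\cdots+c_0$ are identified with points of $\mathbb{Z}_p^r$, which carries normalized Haar measure. The proportion of irreducibles is the Haar measure of the set of irreducible monic degree-$r$ polynomials. Irreducible means not a product of two nonconstant polynomials in $\mathbb{Z}_p[x]$. *)

(* Defs.v *)
From HB Require Import structures.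
From mathcomp Require Import all_boot all_order all_algebra.
From mathcomp Require Import all_classical all_reals all_analysis.

Set Implicit Arguments.
Unset Strict Implicit.
Unset Printing Implicit Defensive.

Import Order.TTheory GRing.Theory Num.Theory.
Local Open Scope ring_scope.
Local Notation "m %%z d" := (modz m d) (at level 40, no associativity).

(* The ring Z_p of p-adic integers, as the inverse limit of Z/p^k Z:   *)
(* an element is a sequence (x_k)_k of integers with                   *)
(*   x_k = x_{k+1} mod p^k  (and hence 0 <= x_k < p^k).                *)
(* As for 'Z_p / 'F_p in MathComp, the base is [maxn p 2] so that the  *)
(* type is a nontrivial ring for every p; for p prime it is p.         *)

Definition padic_base (p : nat) : nat := maxn p 2.
Definition pmodulus (p k : nat) : int := ((padic_base p ^ k)%N)%:Z.

Record padic_int (p : nat) : Type := Padic {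
  pdigits : nat -> int;
  pdigitsP : forall k : nat, pdigits k = (pdigits k.+1 %%z pmodulus p k)%Z }.

Section PadicRing.
Variable p : nat.
Local Notation M := (pmodulus p).
Local Notation Zp := (padic_int p).

Lemma pmodulus_gt0 k : 0 < M k.
Proof. by rewrite /pmodulus ltz_nat expn_gt0 /padic_base leq_max orbT. Qed.

Lemma pmodulus_neq0 k : M k != 0.
Proof. by rewrite gt_eqF // pmodulus_gt0. Qed.

Lemma pmodulusS k : M k.+1 = M k * (padic_base p)%:Z.
Proof. by rewrite /pmodulus expnS mulnC PoszM. Qed.

Lemma modz_dvd_mod (n : int) k : ((n %%z M k.+1) %%z M k = n %%z M k)%Z.
Proof.
apply/eqP; rewrite eqz_mod_dvd.
have -> : (n %%z M k.+1 - n = - ((n %/ M k.+1)%Z * M k.+1))%Z.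
  by rewrite {2}(divz_eq n (M k.+1)) opprD addrCA subrr addr0.
rewrite rpredN [X in (_ * X)%R]pmodulusS mulrA.
by apply: dvdz_mulr; apply: dvdz_mull; exact: dvdzz.
Qed.

Lemma padic_mod (x : Zp) k : (pdigits x k %%z M k)%Z = pdigits x k.
Proof. by rewrite {1}(pdigitsP x k) modz_mod -pdigitsP. Qed.

Lemma padic_cong (x : Zp) k : (pdigits x k %%z M k = pdigits x k.+1 %%z M k)%Z.
Proof. by rewrite padic_mod -pdigitsP. Qed.

Lemma padic_ext (x y : Zp) : (forall k, pdigits x k = pdigits y k) -> x = y.
Proof.
case: x => fx hx; case: y => fy hy /= h.
have e : fx = fy by apply: funext.
subst fy; congr Padic; exact: Prop_irrelevance.
Qed.

Definition padic_red (f : nat -> int)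
  (hf : forall k, (f k %%z M k = f k.+1 %%z M k)%Z) : Zp.
Proof.
refine (@Padic p (fun k => (f k %%z M k)%Z) _) => k.
by rewrite modz_dvd_mod hf.
Defined.

Lemma padic_redE f hf k : pdigits (@padic_red f hf) k = (f k %%z M k)%Z.
Proof. by []. Qed.

Lemma padic_zero_proof k : ((0 : int) %%z M k = (0 : int) %%z M k)%Z.
Proof. by []. Qed.
Definition padic_zero : Zp := padic_red padic_zero_proof.

Lemma padic_one_proof k : ((1 : int) %%z M k = (1 : int) %%z M k)%Z.
Proof. by []. Qed.
Definition padic_one : Zp := padic_red padic_one_proof.

Lemma padic_add_proof (x y : Zp) k :
  ((pdigits x k + pdigits y k) %%z M k
   = (pdigits x k.+1 + pdigits y k.+1) %%z M k)%Z.
Proof. by rewrite -modzDm padic_cong (padic_cong y) modzDm. Qed.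
Definition padic_add (x y : Zp) : Zp := padic_red (padic_add_proof x y).

Lemma padic_opp_proof (x : Zp) k :
  ((- pdigits x k) %%z M k = (- pdigits x k.+1) %%z M k)%Z.
Proof. by rewrite -modzNm padic_cong modzNm. Qed.
Definition padic_opp (x : Zp) : Zp := padic_red (padic_opp_proof x).

Lemma padic_mul_proof (x y : Zp) k :
  ((pdigits x k * pdigits y k) %%z M k
   = (pdigits x k.+1 * pdigits y k.+1) %%z M k)%Z.
Proof. by rewrite -modzMm padic_cong (padic_cong y) modzMm. Qed.
Definition padic_mul (x y : Zp) : Zp := padic_red (padic_mul_proof x y).

HB.instance Definition _ := gen_eqMixin Zp.
HB.instance Definition _ := gen_choiceMixin Zp.

Lemma padic_addA : associative padic_add.
Proof.
move=> x y z; apply: padic_ext => k /=.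
by rewrite modzDml modzDmr addrA.
Qed.

Lemma padic_addC : commutative padic_add.
Proof. by move=> x y; apply: padic_ext => k /=; rewrite addrC. Qed.

Lemma padic_add0 : left_id padic_zero padic_add.
Proof.
move=> x; apply: padic_ext => k /=.
by rewrite mod0z add0r padic_mod.
Qed.

Lemma padic_addN : left_inverse padic_zero padic_opp padic_add.
Proof.
move=> x; apply: padic_ext => k /=.
by rewrite modzDml addNr.
Qed.

HB.instance Definition _ :=
  GRing.isZmodule.Build Zp padic_addA padic_addC padic_add0 padic_addN.

Lemma padic_mulA : associative padic_mul.
Proof.
move=> x y z; apply: padic_ext => k /=.
by rewrite modzMml modzMmr mulrA.
Qed.

Lemma padic_mulC : commutative padic_mul.
Proof. by move=> x y; apply: padic_ext => k /=; rewrite mulrC. Qed.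

Lemma padic_mul1 : left_id padic_one padic_mul.
Proof.
move=> x; apply: padic_ext => k /=.
by rewrite modzMml mul1r padic_mod.
Qed.

Lemma padic_mulDl : left_distributive padic_mul (@padic_add).
Proof.
move=> x y z; apply: padic_ext => k /=.
by rewrite modzMml modzDm mulrDl.
Qed.

Lemma padic_one_neq0 : padic_one != padic_zero.
Proof.
apply/eqP => /(congr1 (fun x => pdigits x 1)) /=.
rewrite mod0z modz_small //.
by rewrite /pmodulus expn1 /padic_base ltz_nat leq_max orbT.
Qed.

HB.instance Definition _ :=
  GRing.Zmodule_isComNzRing.Build Zp padic_mulA padic_mulC padic_mul1
    padic_mulDl padic_one_neq0.

End PadicRing.

(* Normalized Haar measure on Z_p^r.                                   *)
(* A point of Z_p^r is a coefficient vector c : 'I_r -> Z_p.  The      *)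
(* basic open sets are the balls (cylinders)                           *)
(*   B(a, k) = { c | c_i = a_i mod p^k for all i },  of volume p^{-rk}. *)
(* The Haar measure is the Caratheodory extension of this premeasure;  *)
(* its value on any (Borel) set S is the outer measure                 *)
(*   inf { sum_n vol(B_n) | S is covered by countably many balls B_n }. *)

Definition padic_ball (p r : nat) (a : 'I_r -> padic_int p) (k : nat)
  : set ('I_r -> padic_int p) :=
  [set c | forall i : 'I_r, pdigits (c i) k = pdigits (a i) k].

Definition ball_volume (R : realType) (p r k : nat) : R :=
  ((padic_base p ^ (r * k))%N%:R)^-1.

Definition haar_measure (R : realType) (p r : nat)
  (S : set ('I_r -> padic_int p)) : \bar R :=
  ereal_inf [set s : \bar R | exists (a : nat -> 'I_r -> padic_int p)
                                     (k : nat -> nat),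
      (S `<=` \bigcup_n padic_ball (a n) (k n))%classic /\
      s = (\sum_(0 <= n <oo) (ball_volume R p r (k n))%:E)%E].

Definition monic_of (p r : nat) (c : 'I_r -> padic_int p)
  : {poly padic_int p} :=
  'X^r + \sum_(i < r) (c i)%:P * 'X^i.

Definition Zp_irreducible (p : nat) (f : {poly padic_int p}) : Prop :=
  ~ exists g h : {poly padic_int p},
      [/\ (1 < size g)%N, (1 < size h)%N & f = g * h].

(* Main.v *)
(** Let [E_m] be the set of monic polynomials
    of degree [r] whose Newton polygon lies above the line of slope [-m/r]
    ending at [(r, 0)].  By Hensel's lemma an irreducible [f] is either
    irreducible modulo [p], which happens with probability
    [(p^r - p) / (r p^r)], or congruent to [(x - a)^r], and then
    [f(x + a)] lies in [E_1].  An irreducible polynomial has a Newton polygon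
    with one slope, so an irreducible member of [E_1] with constant coefficient of
    valuation [m < r] lies in [E_m]; conversely all such members of [E_m] are
    irreducible because [r] does not divide [m] (Dumas).  If [p^r] divides the
    constant coefficient, then [f] is in [E_r], that is [f(x) = p^r g(x/p)] with
    [g] monic, and [f] is irreducible if and only if [g] is.  Hence the density
    satisfies
      [I = (p^r - p) / (r p^r)
           + p (sum_(1 <= m < r) (1 - 1/p) vol(E_m) + vol(E_r) I)].
    Iterating the underlying set equation from the empty set and from the whole
    space encloses the irreducible locus between clopen sets whose volumes
    converge to the same value; by compactness the Haar outer measure of a clopen
    set is its normalized number of residues modulo [p^k]. *)

Require Import Defs.
From HB Require Import structures.
From mathcomp Require Import all_boot all_order all_algebra all_field.
From mathcomp Require Import all_classical all_reals all_analysis.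
From mathcomp Require Import zify ring lra.

Import Order.TTheory GRing.Theory Num.Theory.
Local Open Scope ring_scope.

Set Implicit Arguments.
Unset Strict Implicit.
Unset Printing Implicit Defensive.

(** * Arithmetic of p-adic integers *)

Section PadicDivisibility.
Variable p : nat.
Local Notation Zp := (padic_int p).
Local Notation M := (pmodulus p).
Local Notation b := (padic_base p).

Lemma padic_base_gt1 : (1 < b)%N.
Proof. by rewrite /padic_base leq_max orbT. Qed.

Lemma padic_base_gt0 : (0 < b)%N.
Proof. exact: ltnW padic_base_gt1. Qed.

Lemma padic_base_prime : prime p -> b = p.
Proof. by move=> /prime_gt1 p1; apply/maxn_idPl. Qed.

Lemma pdigitsD (x y : Zp) k :
  pdigits (x + y) k = ((pdigits x k + pdigits y k) %% M k)%Z.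
Proof. by []. Qed.

Lemma pdigitsN (x : Zp) k : pdigits (- x) k = ((- pdigits x k) %% M k)%Z.
Proof. by []. Qed.

Lemma pdigitsM (x y : Zp) k :
  pdigits (x * y) k = ((pdigits x k * pdigits y k) %% M k)%Z.
Proof. by []. Qed.

Lemma pdigits1 k : pdigits (1 : Zp) k = (1 %% M k)%Z.
Proof. by []. Qed.

Lemma pdigits0 k : pdigits (0 : Zp) k = 0.
Proof. by rewrite -[LHS]/(0 %% M k)%Z mod0z. Qed.

Lemma pdigits_ge0 (x : Zp) k : 0 <= pdigits x k.
Proof. by rewrite -(padic_mod x k) modz_ge0 // pmodulus_neq0. Qed.

Lemma pdigits_lt (x : Zp) k : pdigits x k < M k.
Proof. by rewrite -(padic_mod x k) ltz_pmod // pmodulus_gt0. Qed.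

Lemma pdigits_nat (n : nat) k : pdigits (n%:R : Zp) k = (n%:Z %% M k)%Z.
Proof.
elim: n => [|n IH]; first by rewrite pdigits0 mod0z.
by rewrite mulrS pdigitsD IH pdigits1 modzDm intS.
Qed.

Lemma pdigits_le (x : Zp) j k : (j <= k)%N -> (pdigits x k %% M j)%Z = pdigits x j.
Proof.
move=> /subnK <-; elim: (k - j)%N => [|n IH]; first by rewrite padic_mod.
rewrite -IH addSn [in RHS](pdigitsP x (n + j)).
have /dvdzP[z ->] : (M j %| M (n + j))%Z.
  by rewrite /pmodulus expnD PoszM dvdz_mull.
set u := pdigits _ _.
rewrite {1}(divz_eq u (z * M j)) mulrA addrC.
by rewrite -modzDmr modzMl addr0.
Qed.

Definition pdvd k (x : Zp) := exists y : Zp, x = b%:R ^+ k * y.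

(** If digit [k] vanishes, all later digits are multiples of [b ^ k], and their quotients by [b ^ k]
    form a coherent sequence: the cofactor. *)
Lemma pdigits_pdvd k (x : Zp) : pdigits x k = 0 <-> pdvd k x.
Proof.
have natE : (b%:R ^+ k : Zp) = (b ^ k)%N%:R by rewrite natrX.
split=> [x0|[y ->]]; last first.
  by rewrite natE pdigitsM pdigits_nat modzz mul0r mod0z.
have dv j : (M k %| pdigits x (j + k))%Z.
  by apply/dvdz_mod0P; rewrite pdigits_le ?leq_addl.
have eqd j : pdigits x (j + k) = (pdigits x (j + k) %/ M k)%Z * M k.
  by rewrite divzK.
have MD i j : M (i + j) = M i * M j by rewrite /pmodulus expnD PoszM.
pose f j := (pdigits x (j + k) %/ M k)%Z.
have fP j : f j = (f j.+1 %% M j)%Z.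
  have := pdigitsP x (j + k); rewrite -addSn eqd (eqd j.+1) MD.
  rewrite -mulz_modl ?pmodulus_gt0 // => h.
  by apply: (mulIf (pmodulus_neq0 p k)); rewrite -h.
exists (Padic fP); apply: padic_ext => j.
rewrite natE pdigitsM pdigits_nat /= modzMml -(pdigits_le x (leq_addr k j)).
by rewrite eqd mulrC.
Qed.

Lemma pdigits_eq k (x y : Zp) : pdigits x k = pdigits y k <-> pdvd k (x - y).
Proof.
rewrite -pdigits_pdvd pdigitsD pdigitsN modzDmr; split=> [->|].
  by rewrite subrr mod0z.
move=> /eqP; rewrite -(mod0z (M k)) eqz_mod_dvd subr0 => h.
by rewrite -(padic_mod x) -(padic_mod y); apply/eqP; rewrite eqz_mod_dvd.
Qed.

Lemma pdvd0 k : pdvd k 0.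
Proof. by exists 0; rewrite mulr0. Qed.

Lemma pdvdD k x y : pdvd k x -> pdvd k y -> pdvd k (x + y).
Proof. by move=> [u ->] [v ->]; exists (u + v); rewrite mulrDr. Qed.

Lemma pdvdN k x : pdvd k x -> pdvd k (- x).
Proof. by move=> [u ->]; exists (- u); rewrite mulrN. Qed.

Lemma pdvdB k x y : pdvd k x -> pdvd k y -> pdvd k (x - y).
Proof. by move=> hx hy; apply: pdvdD => //; apply: pdvdN. Qed.

Lemma pdvdM k l x y : pdvd k x -> pdvd l y -> pdvd (k + l) (x * y).
Proof. by move=> [u ->] [v ->]; exists (u * v); rewrite exprD mulrACA. Qed.

Lemma pdvd_expM k x : pdvd k (b%:R ^+ k * x).
Proof. by exists x. Qed.

Lemma pdvd_le k l x : (k <= l)%N -> pdvd l x -> pdvd k x.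
Proof. by move=> /subnK <- [u ->]; exists (b%:R ^+ (l - k) * u); rewrite addnC exprD mulrA. Qed.

Lemma pdvd0l x : pdvd 0 x.
Proof. by exists x; rewrite expr0 mul1r. Qed.

Lemma pdvd_inf x : (forall k, pdvd k x) -> x = 0.
Proof.
move=> h; apply: padic_ext => k; rewrite pdigits0.
exact/pdigits_pdvd.
Qed.

(** Digit [k + j] of [b ^ k * z] is [b ^ k] times digit [j] of [z], so [z] can be read off from the
    product. *)
Lemma padic_expI k : injective ( *%R (b%:R ^+ k : Zp)).
Proof.
move=> x y exy; apply: subr0_eq; set z := x - y.
have z0 : b%:R ^+ k * z = 0 by rewrite /z mulrBr exy subrr.
apply: padic_ext => j; rewrite pdigits0.
have := congr1 (fun u => pdigits u (k + j)) z0.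
rewrite -natrX pdigitsM pdigits_nat pdigits0 modzMml.
have -> : M (k + j) = M k * M j by rewrite /pmodulus expnD PoszM.
rewrite -[((b ^ k)%N : int)]/(M k) -mulz_modr ?pmodulus_gt0 //.
rewrite pdigits_le ?leq_addl // => /eqP.
by rewrite mulf_eq0 (negPf (pmodulus_neq0 _ _)) => /eqP.
Qed.

Lemma pdvd_expM2l k l x : pdvd (k + l) (b%:R ^+ k * x) -> pdvd l x.
Proof. by move=> [y]; rewrite exprD -mulrA => /padic_expI ->; exists y. Qed.

Lemma pdvd_not1P x : x != 0 -> exists a y, x = b%:R ^+ a * y /\ ~ pdvd 1 y.
Proof.
move=> x0; have [k hk] : exists k, ~ pdvd k x.
  by apply: contrapT => /forallNP h; case/eqP: x0; apply: pdvd_inf => k; apply: contrapT; exact: h.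
have ex : exists k, `[< ~ pdvd k x >] by exists k; apply/asboolP.
case: (ex_minnP ex) => -[/asboolP []|a /asboolP ha amin]; first exact: pdvd0l.
have [y xE] : pdvd a x by apply: contrapT => /asboolP /amin; rewrite ltnn.
exists a, y; split=> // -[z yE]; apply: ha; exists z.
by rewrite xE yE expr1 mulrA exprSr.
Qed.

End PadicDivisibility.

(** * The residue field *)

Section Residue.
Variable p : nat.
Local Notation Zp := (padic_int p).
Local Notation b := (padic_base p).

(** For an arbitrary base, ['F_b] is the prime field of the least prime factor [pdiv b]. Since
    [pdiv b] divides [b], reduction is a ring morphism before primality of [b] is assumed. *)
Definition padic_residue (x : Zp) : 'F_b := (pdigits x 1)%:~R.

Lemma Fp_nat_eq0 (n : nat) : (n%:R == 0 :> 'F_b) = (pdiv b %| n)%N.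
Proof.
have /prime_gt1 h : prime (pdiv b) := pdiv_prime (padic_base_gt1 p).
by rewrite Zp_nat -val_eqE /= Zp_cast.
Qed.

Lemma int_Fp_mod (z : int) : ((z %% pmodulus p 1)%Z)%:~R = z%:~R :> 'F_b.
Proof.
rewrite {2}(divz_eq z (pmodulus p 1)); set q := divz _ _; set t := modz _ _.
rewrite (intrD _ (q * _) t) intrM.
rewrite [X in _ * X + _](_ : _ = 0) ?mulr0 ?add0r // -pmulrn.
by apply/eqP; rewrite Fp_nat_eq0 expn1 pdiv_dvd.
Qed.

Fact padic_residue_is_additive : zmod_morphism padic_residue.
Proof.
move=> x y; rewrite /padic_residue pdigitsD pdigitsN modzDmr int_Fp_mod.
by rewrite rmorphB.
Qed.

HB.instance Definition _ :=
  GRing.isZmodMorphism.Build Zp 'F_b padic_residue padic_residue_is_additive.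

Fact padic_residue_is_multiplicative : monoid_morphism padic_residue.
Proof.
split=> [|x y]; first by rewrite /padic_residue pdigits1 int_Fp_mod.
by rewrite /padic_residue pdigitsM int_Fp_mod rmorphM.
Qed.

HB.instance Definition _ := GRing.isMonoidMorphism.Build Zp 'F_b padic_residue
  padic_residue_is_multiplicative.

(** A section of the reduction map as sets only. It sends 0 to 0 and 1 to 1, so coefficientwise
    lifts of monic polynomials are monic. *)
Definition padic_lift (u : 'F_b) : Zp := (u : nat)%:R.

Lemma padic_liftK : cancel padic_lift padic_residue.
Proof. by move=> u; rewrite rmorph_nat natr_Zp. Qed.

Hypothesis b_pr : prime b.

Lemma padic_residue_eq0 x : padic_residue x = 0 <-> pdvd 1 x.
Proof.
split=> [|[y ->]]; last first.
  rewrite expr1 rmorphM rmorph_nat /=; apply/eqP.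
  by rewrite mulf_eq0 Fp_nat_eq0 pdiv_dvd.
rewrite -pdigits_pdvd /padic_residue.
have := pdigits_lt x 1; have := pdigits_ge0 x 1.
case: (pdigits x 1) => // n _; rewrite /pmodulus expn1 ltz_nat => n_lt.
rewrite -pmulrn => /eqP; rewrite Fp_nat_eq0 pdiv_id //.
by case: n n_lt => // n n_lt /dvdn_leq -/(_ isT); rewrite leqNgt n_lt.
Qed.

Lemma padic_residue_eq x y : padic_residue x = padic_residue y <-> pdvd 1 (x - y).
Proof.
rewrite -padic_residue_eq0 rmorphB /=; split=> [->|/subr0_eq//].
by rewrite subrr.
Qed.

(* Exact valuations add up because the residue field is a domain. *)
Lemma pdvd_not1M (x y : Zp) : ~ pdvd 1 x -> ~ pdvd 1 y -> ~ pdvd 1 (x * y).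
Proof.
rewrite -!padic_residue_eq0 rmorphM /= => hx hy /eqP.
by rewrite mulf_eq0 => /orP[] /eqP.
Qed.

Lemma pdvd_not1_inv (x : Zp) : ~ pdvd 1 x -> exists s, pdvd 1 (1 - x * s).
Proof.
move=> hx; exists (padic_lift (padic_residue x)^-1).
apply/padic_residue_eq0; rewrite rmorphB rmorphM rmorph1 /=.
have -> := padic_liftK (padic_residue x)^-1.
rewrite mulfV ?subrr //; apply/eqP => /padic_residue_eq0; exact: hx.
Qed.

Lemma pdvd_expM_not1 k l (x : Zp) : ~ pdvd 1 x -> pdvd l (b%:R ^+ k * x) -> (l <= k)%N.
Proof.
move=> hx hl; rewrite leqNgt; apply/negP => kl; apply: hx.
apply: (@pdvd_expM2l _ k); apply: pdvd_le hl; lia.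
Qed.

Lemma padic_mulf_eq0 (x y : Zp) : x * y = 0 -> x = 0 \/ y = 0.
Proof.
move=> xy0; apply: contrapT => /not_orP[/eqP /pdvd_not1P [k [u [xE hu]]]].
move=> /eqP /pdvd_not1P [l [v [yE hv]]].
have : pdvd (k + l).+1 (b%:R ^+ (k + l) * (u * v)).
  rewrite exprD mulrACA -xE -yE xy0; exact: pdvd0.
by move/(pdvd_expM_not1 (pdvd_not1M hu hv)); rewrite ltnn.
Qed.

End Residue.

(** * Compactness *)

Section ResidueVectors.
Variables p n : nat.
Local Notation Zp := (padic_int p).
Local Notation b := (padic_base p).
Local Notation V := ('I_n -> Zp).

Definition agree k (c d : V) := forall i, pdigits (c i) k = pdigits (d i) k.

Definition is_level k (A : set V) := forall c d, agree k c d -> A c -> A d.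

Lemma agree_sym k c d : agree k c d -> agree k d c.
Proof. by move=> h i; rewrite h. Qed.

Lemma agree_trans k c d e : agree k c d -> agree k d e -> agree k c e.
Proof. by move=> h h' i; rewrite h. Qed.

Lemma agree_le j k c d : (j <= k)%N -> agree k c d -> agree j c d.
Proof. by move=> jk h i; rewrite -!(pdigits_le _ jk) h. Qed.

Lemma agreeP k c d : agree k c d <-> forall i, pdvd k (c i - d i).
Proof. by split=> h i; apply/pdigits_eq. Qed.

Lemma pdigits_ltn (x : Zp) k : (`|pdigits x k| < b ^ k)%N.
Proof. by rewrite -ltz_nat gez0_abs ?pdigits_ge0 // pdigits_lt. Qed.

Definition vec_mod k (c : V) : {ffun 'I_n -> 'I_(b ^ k)} :=
  [ffun i => Ordinal (pdigits_ltn (c i) k)].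

Definition vec_lift k (t : {ffun 'I_n -> 'I_(b ^ k)}) : V :=
  fun i => (t i : nat)%:R.

Lemma vec_mod_eq k c d : vec_mod k c = vec_mod k d <-> agree k c d.
Proof.
split=> [/ffunP h i|h].
  have := congr1 val (h i); rewrite !ffunE /= => e.
  by rewrite -[LHS]gez0_abs ?pdigits_ge0 // e gez0_abs ?pdigits_ge0.
by apply/ffunP => i; rewrite !ffunE; apply: val_inj => /=; rewrite h.
Qed.

Lemma vec_liftK k : cancel (@vec_lift k) (vec_mod k).
Proof.
move=> t; apply/ffunP => i; rewrite ffunE; apply: val_inj => /=.
by rewrite pdigits_nat modz_small // ltz_nat ltn_ord.
Qed.

Lemma agree_lift_mod k c : agree k (vec_lift (vec_mod k c)) c.
Proof. by apply/vec_mod_eq; rewrite vec_liftK. Qed.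

Lemma is_level_le j k A : (j <= k)%N -> is_level j A -> is_level k A.
Proof. by move=> jk h c d cd; apply/h/agree_le/cd. Qed.

(** König's lemma: if a residue class meets every [C N], so does one of the finitely many classes
    into which it splits. The resulting chain of classes converges to a point, which lies in each
    [C N] because membership depends on finitely many digits. *)
Lemma padic_compact (l : nat -> nat) (C : nat -> set V) :
    (forall N, is_level (l N) (C N)) ->
    (forall N c, C N.+1 c -> C N c) ->
    (forall N, exists c, C N c) ->
  exists x, forall N, C N x.
Proof.
move=> Cl Cdecr Cne.
have Cle N N' c : (N <= N')%N -> C N' c -> C N c.
  by move=> /subnK <-; elim: (N' - N)%N => // m IH /Cdecr.
pose good k c := forall N, exists2 d, C N d & agree k c d.
have step (s : nat * V) :
    exists d, good s.1 s.2 -> agree s.1 s.2 d /\ good s.1.+1 d.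
  (* The step has to be a total function, hence an arbitrary value for a class that is not good. *)
  case: s => k c /=; have [gkc|] := pselect (good k c); last by exists c.
  apply: contrapT => no.
  have {no}/choice[N NP] t : exists N, agree k c (@vec_lift k.+1 t) ->
      forall d, C N d -> ~ agree k.+1 (vec_lift t) d.
    apply: contrapT => /forallNP h; apply: no; exists (vec_lift t) => _.
    split; first by apply: contrapT => na; apply: (h 0%N) => /na.
    move=> N; apply: contrapT => nd; apply: (h N) => _ d Cd ad.
    by apply: nd; exists d.
  (* If every subclass [t] missed [C (N t)], the whole class would miss [C] at the largest of these
     indices, because the sets decrease. *)
  have [d Cd cd] := gkc (\max_t N t)%N.
  have ad := agree_lift_mod k.+1 d.
  apply: (NP (vec_mod k.+1 d) _ d) => //.
    by apply: agree_trans cd _; apply/agree_sym/agree_le/ad.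
  by apply: Cle Cd; exact: leq_bigmax.
have [F FP] := choice step.
have [c0 _] := Cne 0%N.
pose fix s k := if k is k'.+1 then F (k', s k') else c0.
have sgood k : good k (s k).
  elim: k => [|k /(FP (k, s k))[]//] N.
  have [d Cd] := Cne N; exists d => // i.
  by rewrite -[LHS]padic_mod -[RHS]padic_mod /pmodulus expn0 !modz1.
have sP k : agree k (s k) (s k.+1) by case: (FP (k, s k) (sgood k)).
have xP i k : pdigits (s k i) k = (pdigits (s k.+1 i) k.+1 %% pmodulus p k)%Z.
  by rewrite sP -pdigitsP.
exists (fun i => Padic (xP i)) => N.
have [d Cd sd] := sgood (l N) N.
by apply: (Cl N d) Cd; apply: agree_sym.
Qed.

End ResidueVectors.

(** * Monic polynomials as coefficient vectors, and limits of factors *)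

Section MonicOf.
Variables p : nat.
Local Notation Zp := (padic_int p).
Local Notation b := (padic_base p).

Lemma monic_of_poly n (c : 'I_n -> Zp) :
  monic_of c = 'X^n + \poly_(j < n) oapp c 0 (insub j).
Proof.
rewrite /monic_of poly_def; congr (_ + _); apply: eq_bigr => i _.
by rewrite valK mul_polyC.
Qed.

Lemma size_monic_of n (c : 'I_n -> Zp) : size (monic_of c) = n.+1.
Proof.
by rewrite monic_of_poly size_polyDl ?size_polyXn // ltnS size_poly.
Qed.

Lemma monic_of_monic n (c : 'I_n -> Zp) : monic_of c \is monic.
Proof.
rewrite monicE monic_of_poly lead_coefDl ?lead_coefXn //.
by rewrite size_polyXn ltnS size_poly.
Qed.

Lemma coef_monic_of n (c : 'I_n -> Zp) (i : 'I_n) : (monic_of c)`_i = c i.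
Proof.
rewrite monic_of_poly coefD coefXn coef_poly ltn_ord valK /=.
by rewrite ltn_eqF ?ltn_ord // add0r.
Qed.

Lemma monic_of_coef n (f : {poly Zp}) : f \is monic -> size f = n.+1 ->
  f = monic_of (fun i : 'I_n => f`_i).
Proof.
move=> fm fs; apply/polyP => j; have [jn|] := ltnP j n.
  by rewrite (coef_monic_of _ (Ordinal jn)).
rewrite leq_eqVlt => /orP[/eqP <-|nj]; last first.
  by rewrite !nth_default ?fs // size_monic_of.
have /eqP := monicP fm; rewrite lead_coefE fs /= => /eqP ->.
have := monicP (monic_of_monic (fun i : 'I_n => f`_i)).
by rewrite lead_coefE size_monic_of.
Qed.

Lemma pdvd_poly k (P : {poly Zp}) :
  (forall j, pdvd k P`_j) -> exists Q, P = b%:R ^+ k *: Q /\ (size Q <= size P)%N.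
Proof.
move=> /choice[q qE]; exists (\poly_(j < size P) q j); split; last exact: size_poly.
apply/polyP => j; rewrite coefZ coef_poly; case: ltnP => // h.
by rewrite mulr0 nth_default.
Qed.

Lemma agree_monic_of n k (c d : 'I_n -> Zp) :
  agree k c d <-> exists P, monic_of c = monic_of d + b%:R ^+ k *: P.
Proof.
split=> [/agreeP h|[P e]]; last first.
  apply/agreeP => i; exists P`_i.
  by rewrite -!coef_monic_of e coefD coefZ addrC addKr.
have [|Q [E _]] := @pdvd_poly k (monic_of c - monic_of d); last first.
  by exists Q; rewrite -E addrC subrK.
move=> j; rewrite !monic_of_poly opprD addrACA subrr add0r coefB !coef_poly.
case: ltnP => jn; last by rewrite subrr; apply: pdvd0.
by rewrite insubT /=; apply: h.
Qed.

(** The monic [g] of degree [n] dividing [f] modulo [b ^ N] form decreasing nonempty clopen sets, so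
    some [g] divides [f] modulo every power. The remainder of [f] by this [g] is divisible by every
    [b ^ N], hence zero. *)
Lemma factor_limit (f : {poly Zp}) n :
    (forall N, exists g h rho, [/\ g \is monic, size g = n.+1
                             & f = g * h + b%:R ^+ N *: rho]) ->
  exists g h, [/\ g \is monic, size g = n.+1 & f = g * h].
Proof.
move=> H.
pose C N (c : 'I_n -> Zp) :=
  exists h rho, f = monic_of c * h + b%:R ^+ N *: rho.
have [|||x xP] := @padic_compact p n id C.
- move=> N c d /agree_monic_of[P E] [h [rho fE]]; exists h, (P * h + rho).
  rewrite fE E.
  by rewrite mulrDl -scalerAl scalerDr addrA.
- move=> N c [h [rho fE]]; exists h, (b%:R *: rho).
  by rewrite fE exprSr scalerA.
- move=> N; have [g [h [rho [gm gs fE]]]] := H N.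
  by exists (fun i : 'I_n => g`_i); exists h, rho; rewrite -monic_of_coef.
have gm := monic_of_monic x.
exists (monic_of x), (Pdiv.Ring.rdivp f (monic_of x)).
rewrite gm size_monic_of; split=> //.
rewrite {1}(Pdiv.RingMonic.rdivp_eq gm f) mulrC.
rewrite (_ : Pdiv.Ring.rmodp _ _ = 0) ?addr0 //.
apply/polyP => j; rewrite coef0; apply: pdvd_inf => N.
have [h [rho fE]] := xP N.
rewrite {1}fE Pdiv.RingMonic.rmodpD // mulrC Pdiv.RingMonic.rmodp_mull // add0r.
by rewrite Pdiv.RingMonic.rmodpZ // coefZ; exact: pdvd_expM.
Qed.

End MonicOf.

(** * Newton polygons *)

Section Weights.
Variables (p A B : nat).
Local Notation Zp := (padic_int p).
Local Notation b := (padic_base p).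

(* The monomial [x * 'X^j] has weight at least [s], where the uniformizer *)
(* has weight [A] and ['X] has weight [B].                                *)
Definition wt s j (x : Zp) := exists2 t, (s <= A * t + B * j)%N & pdvd t x.

Definition wpoly s (P : {poly Zp}) := forall j, wt s j P`_j.

Lemma wt0 s j : (0 < A)%N -> wt s j 0.
Proof. by move=> A0; exists s; [nia|apply: pdvd0]. Qed.

Lemma wt_le s s' j x : (s <= s')%N -> wt s' j x -> wt s j x.
Proof. by move=> ss' [t h h']; exists t => //; apply: leq_trans h. Qed.

Lemma wt_triv s j x : (s <= B * j)%N -> wt s j x.
Proof. by move=> h; exists 0%N; [lia|apply: pdvd0l]. Qed.

Lemma wtD s j x y : wt s j x -> wt s j y -> wt s j (x + y).
Proof.
move=> [t h hx] [u h' hy]; case: (leqP t u) => tu.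
  by exists t => //; apply: pdvdD => //; apply: pdvd_le hy.
by exists u => //; apply: pdvdD => //; apply: pdvd_le (ltnW tu) hx.
Qed.

Lemma wtN s j x : wt s j x -> wt s j (- x).
Proof. by move=> [t h hx]; exists t => //; apply: pdvdN. Qed.

Lemma wtM s s' i j x y : wt s i x -> wt s' j y -> wt (s + s') (i + j) (x * y).
Proof.
move=> [t h hx] [u h' hy]; exists (t + u)%N; first by nia.
exact: pdvdM.
Qed.

Lemma wt_sum s j (I : Type) (r : seq I) (Q : pred I) (F : I -> Zp) :
  (0 < A)%N -> (forall i, Q i -> wt s j (F i)) -> wt s j (\sum_(i <- r | Q i) F i).
Proof.
move=> A0 h; elim/big_ind: _ => //; first exact: wt0.
by move=> x y; apply: wtD.
Qed.

Lemma wpoly_le s s' P : (s <= s')%N -> wpoly s' P -> wpoly s P.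
Proof. by move=> h H j; apply: wt_le (H j). Qed.

Lemma wpolyD s P Q : wpoly s P -> wpoly s Q -> wpoly s (P + Q).
Proof. by move=> hP hQ j; rewrite coefD; apply: wtD. Qed.

Lemma wpolyN s P : wpoly s P -> wpoly s (- P).
Proof. by move=> hP j; rewrite coefN; apply: wtN. Qed.

Lemma wpolyB s P Q : wpoly s P -> wpoly s Q -> wpoly s (P - Q).
Proof. by move=> hP hQ; apply: wpolyD => //; apply: wpolyN. Qed.

Lemma wpolyZ e s c P : pdvd e c -> wpoly s P -> wpoly (A * e + s) (c *: P).
Proof.
move=> hc hP j; rewrite coefZ -[j]add0n; apply: wtM (hP j).
by exists e => //; lia.
Qed.

Lemma wpoly_expZ e s P : wpoly (A * e + s) (b%:R ^+ e *: P) -> wpoly s P.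
Proof.
move=> h j; have [t ht] := h j; rewrite coefZ.
case: (leqP e t) => et hd; last by apply: wt_triv; nia.
exists (t - e)%N; first by nia.
by apply: (@pdvd_expM2l _ e); rewrite subnKC.
Qed.

Hypothesis A0 : (0 < A)%N.

Lemma wpoly0 s : wpoly s 0.
Proof. by move=> j; rewrite coef0; apply: wt0. Qed.

Lemma wpolyM s s' P Q : wpoly s P -> wpoly s' Q -> wpoly (s + s') (P * Q).
Proof.
move=> hP hQ j; rewrite coefM; apply: wt_sum => // i _.
rewrite -{1}(subnKC (ltn_ord i : (i <= j)%N)); exact: wtM.
Qed.

Lemma wpolyXn n : wpoly (B * n) 'X^n.
Proof.
move=> j; rewrite coefXn; case: eqP => [->|_]; last exact: wt0.
exact: wt_triv.
Qed.

(** Division loses no weight, because the monic [g] is nowhere lighter than its leading monomial: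
    each quotient monomial [q] has weight at least [s], and [q * g] is as heavy as the dividend. *)
Lemma wpoly_div n (g : {poly Zp}) s P :
    g \is monic -> size g = n.+1 -> wpoly (B * n) g -> wpoly (s + B * n) P ->
  exists k rho, [/\ P = k * g + rho, (size rho <= n)%N, wpoly s k
                  & wpoly (s + B * n) rho].
Proof.
move=> gm gs wg; elim: {P}(size P) {-2}P (leqnn (size P)) => [|m IH] P.
  rewrite leqn0 size_poly_eq0 => /eqP -> _; exists 0, 0.
  by rewrite mul0r add0r size_poly0; split=> //; apply: wpoly0.
move=> Pm wP; have [sP|sP] := leqP (size P) n.
  by exists 0, P; rewrite mul0r add0r; split=> //; apply: wpoly0.
pose d := ((size P).-1 - n)%N; pose q := (lead_coef P) *: 'X^d : {poly Zp}.
have dE : ((size P).-1 = d + n)%N by rewrite /d subnK // -ltnS (ltn_predK sP).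
have wq : wpoly s q.
  move=> j; rewrite coefZ coefXn; case: eqP => [->|_]; last by rewrite mulr0; apply: wt0.
  rewrite mulr1; have [t ht hd] := wP (size P).-1; exists t => //.
  by rewrite -(leq_add2r (B * n)) -addnA -mulnDr -dE.
have [||k [rho [E sr wk wr]]] := IH (P - q * g).
- rewrite -ltnS (leq_trans _ Pm) // -(ltn_predK sP) ltnS dE.
  apply/leq_sizeP => j hj; rewrite coefB -scalerAl coefZ coefXnM.
  rewrite ltnNge (leq_trans (leq_addr n d) hj) /=.
  have [->|nj] := eqVneq j (d + n)%N.
    have := monicP gm; rewrite addKn !lead_coefE gs dE /= => ->.
    by rewrite mulr1 subrr.
  have {nj}hj : (d + n < j)%N by rewrite ltn_neqAle eq_sym nj.
  rewrite !nth_default ?mulr0 ?subrr ?gs //; first by rewrite ltn_subRL.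
  by rewrite -(ltn_predK sP) dE.
- by apply: wpolyB => //; apply: wpolyM.
exists (q + k), rho; split=> //; last exact: wpolyD.
by rewrite mulrDl -addrA -E addrC subrK.
Qed.

Lemma wt_exact u j x : (prime b) -> wt u j x -> ~ wt u.+1 j x ->
  exists e y, [/\ x = b%:R ^+ e * y, ~ pdvd 1 y & (u = A * e + B * j)%N].
Proof.
move=> b_pr h h'; have [x0|x0] := eqVneq x 0; first by case: h'; rewrite x0; apply: wt0.
have [e [y [xE hy]]] := pdvd_not1P x0; exists e, y; split=> //.
have [t ht] := h; rewrite xE => /(pdvd_expM_not1 b_pr hy) te.
apply/eqP; rewrite eqn_leq; apply/andP; split; first by nia.
rewrite leqNgt; apply/negP => lt; apply: h'; exists e => //; rewrite xE.
exact: pdvd_expM.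
Qed.

Lemma wpoly_least u P : ~ wpoly u P ->
  exists i, ~ wt u i P`_i /\ forall j, (j < i)%N -> wt u j P`_j.
Proof.
move=> /existsNP[i0 hi0].
have ex : exists i, `[< ~ wt u i P`_i >] by exists i0; apply/asboolP.
case: (ex_minnP ex) => i /asboolP hi imin; exists i; split=> // j ji.
by apply: contrapT => /asboolP /imin; rewrite leqNgt ji.
Qed.

Hypothesis b_pr : prime b.

(** Gauss's lemma for the weighted valuation. Let [i] and [j] be the leftmost degrees where [P] and
    [Q] attain their minimal weights. In the coefficient of degree [i + j], the product of these two
    terms has weight exactly [u + w], and every other term is strictly heavier. *)
Lemma wpoly_gauss u w P Q : wpoly u P -> ~ wpoly u.+1 P ->
  wpoly w Q -> ~ wpoly w.+1 Q -> ~ wpoly (u + w).+1 (P * Q).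
Proof.
move=> hP /wpoly_least[i [nP lP]] hQ /wpoly_least[j [nQ lQ]] /(_ (i + j)%N).
rewrite coefM.
have ii : (i < (i + j).+1)%N by lia.
rewrite (bigD1 (Ordinal ii)) //= addKn; set S := \sum_(_ | _) _ => h.
have wS : wt (u + w).+1 (i + j) S.
  apply: wt_sum => // a /eqP ai; have aij := ltn_ord a.
  have [lt|le] := ltnP a i.
    rewrite -{1}(subnKC (ltn_ord a : (a <= i + j)%N)) -addSn.
    by apply: wtM; [apply: lP|apply: hQ].
  have {}le : (i < a)%N.
    rewrite ltn_neqAle le andbT; apply/eqP => e; apply: ai.
    exact/val_inj.
  rewrite -{1}(subnKC (ltn_ord a : (a <= i + j)%N)) -addnS.
  by apply: wtM; [apply: hP|apply: lQ; lia].
have {wS}h : wt (u + w).+1 (i + j) (P`_i * Q`_j).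
  by rewrite -[_ * _](addrK S); apply: wtD => //; apply: wtN.
have [e [y [PE hy ue]]] := wt_exact b_pr (hP i) nP.
have [e' [y' [QE hy' we]]] := wt_exact b_pr (hQ j) nQ.
have [t ht] := h; rewrite PE QE mulrACA -exprD.
by move=> /(pdvd_expM_not1 b_pr (pdvd_not1M b_pr hy hy')) te; nia.
Qed.

(** The leading coefficient 1 has weight exactly [B * n], which bounds the weight of [g]. *)
Lemma wpoly_max n g : g \is monic -> size g = n.+1 ->
  exists u, [/\ wpoly u g, ~ wpoly u.+1 g & (u <= B * n)%N].
Proof.
move=> gm gs.
have bd u : wpoly u g -> (u <= B * n)%N.
  move=> /(_ n)[t]; have := monicP gm; rewrite lead_coefE gs /= => ->.
  case: t => [|t] ht; first by nia.
  move=> /(pdvd_le (ltn0Sn t)) /(padic_residue_eq0 b_pr).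
  by rewrite rmorph1 => /eqP; rewrite oner_eq0.
have ex : exists u, `[< wpoly u g >].
  by exists 0%N; apply/asboolP => j; apply: wt_triv.
have bd' u : `[< wpoly u g >] -> (u <= B * n)%N by move=> /asboolP /bd.
case: (ex_maxnP ex bd') => u /asboolP hu umax; exists u; split=> //.
  by move=> /asboolP /umax; rewrite ltnn.
exact: bd.
Qed.

(** The minimal weights of [g] and [h] are at most [B * s] and [B * t], and by Gauss's lemma their
    sum reaches [B * (s + t)]; both bounds are therefore equalities. *)
Lemma wpoly_factor s t g h : g \is monic -> h \is monic ->
  size g = s.+1 -> size h = t.+1 -> wpoly (B * (s + t)) (g * h) ->
  wpoly (B * s) g /\ wpoly (B * t) h.
Proof.
move=> gm hm gs hs w.
have [u [wu nu ub]] := wpoly_max gm gs.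
have [v [wv nv vb]] := wpoly_max hm hs.
have := wpoly_gauss wu nu wv nv.
have [le|lt] := leqP (u + v).+1 (B * (s + t)).
  by move=> H; exfalso; apply/H/(wpoly_le le).
have -> : (B * s = u)%N by nia.
by have -> : (B * t = v)%N by nia.
Qed.

End Weights.

(** * Factorization criteria: vertices, slopes and rescaling *)

Section Factorization.
Variable p : nat.
Local Notation Zp := (padic_int p).
Local Notation b := (padic_base p).
Lemma size_monic_cofactor (f g h : {poly Zp}) r n : f \is monic -> size f = r.+1 ->
  g \is monic -> size g = n.+1 -> f = g * h ->
  h \is monic /\ size h = (r - n).+1.
Proof.
move=> fm fs gm gs fE; have hm : h \is monic by move: fm; rewrite fE monicMl.
split=> //; have := fs; rewrite fE size_monicM // ?monic_neq0 // gs.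
have : size h != 0%N by rewrite size_poly_eq0 monic_neq0.
by case: (size h) => // m _ /=; lia.
Qed.

(** For [g] of degree at most [s], this is [b ^ s * g (X / b)] written without denominators. *)
Definition stretch s (g : {poly Zp}) : {poly Zp} :=
  \poly_(j < s.+1) (b%:R ^+ (s - j) * g`_j).

Lemma coef_stretch s g j : (j <= s)%N -> (stretch s g)`_j = b%:R ^+ (s - j) * g`_j.
Proof. by move=> js; rewrite coef_poly ltnS js. Qed.

Lemma stretch_inj s (g h : {poly Zp}) : (size g <= s.+1)%N -> (size h <= s.+1)%N ->
  stretch s g = stretch s h -> g = h.
Proof.
move=> sg sh e; apply/polyP => j; have [js|sj] := leqP j s.
  by apply: (@padic_expI p (s - j)%N); rewrite -!coef_stretch // e.
by rewrite !nth_default // (leq_trans _ sj).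
Qed.

Lemma stretchM s t (g h : {poly Zp}) : (size g <= s.+1)%N -> (size h <= t.+1)%N ->
  stretch (s + t) (g * h) = stretch s g * stretch t h.
Proof.
move=> sg sh; apply/polyP => j; rewrite coef_poly !coefM.
(* Beyond degree [s + t] the truncation gives 0; the convolution also vanishes there, since each
   term has a factor of index beyond its size. *)
have -> : (if (j < (s + t).+1)%N
      then b%:R ^+ (s + t - j) * \sum_(i < j.+1) g`_i * h`_(j - i) else 0)
    = b%:R ^+ (s + t - j) * \sum_(i < j.+1) g`_i * h`_(j - i).
  case: ltnP => // jst; rewrite big1 ?mulr0 // => i _.
  have [si|si] := ltnP s i; first by rewrite nth_default ?mul0r // (leq_trans sg).
  by rewrite [h`__]nth_default ?mulr0 // (leq_trans sh) //; lia.
rewrite mulr_sumr; apply: eq_bigr => i _; rewrite !coef_poly !ltnS.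
have [si|si] := leqP i s; last by rewrite nth_default ?(leq_trans sg) // !mul0r mulr0.
have [ti|ti] := leqP (j - i) t; last first.
  by rewrite [h`__]nth_default ?(leq_trans sh) // !mulr0.
rewrite mulrACA -exprD; congr (_ ^+ _ * _).
have := ltn_ord i; lia.
Qed.

Lemma size_stretch s (g : {poly Zp}) : g \is monic -> size g = s.+1 -> size (stretch s g) = s.+1.
Proof.
move=> gm gs; apply/anti_leq; rewrite size_poly /= ltnNge; apply/negP => h.
have := coef_stretch g (leqnn s); rewrite nth_default // subnn mul1r => /esym.
have := monicP gm; rewrite lead_coefE gs /= => -> /eqP; by rewrite oner_eq0.
Qed.

Lemma unstretch s (g : {poly Zp}) : g \is monic -> size g = s.+1 -> wpoly 1 1 s g ->
  exists g' : {poly Zp}, size g' = s.+1 /\ g = stretch s g'.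
Proof.
move=> gm gs wg.
have /choice[q qE] j : exists y, (j <= s)%N -> g`_j = b%:R ^+ (s - j) * y.
  have [t ht dt] := wg j.
  have [y E] : pdvd (s - j) g`_j by apply: pdvd_le dt; lia.
  by exists y.
have E : g = stretch s (\poly_(j < s.+1) q j).
  apply/polyP => j; rewrite !coef_poly; case: ltnP => h; first by rewrite qE.
  by rewrite nth_default // gs.
exists (\poly_(j < s.+1) q j); split=> //.
rewrite size_poly_eq //= -[q s]mul1r -[1](expr0 b%:R) -(subnn s) -qE //.
by have := monicP gm; rewrite lead_coefE gs /= => ->; rewrite oner_eq0.
Qed.

Lemma comp_irreducible (f : {poly Zp}) (a : Zp) :
  Zp_irreducible f -> Zp_irreducible (f \Po ('X + a%:P)).
Proof.
have sz1 (q : {poly Zp}) c : (1 < size q)%N -> (1 < size (q \Po ('X - c%:P)))%N.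
  rewrite !ltnNge => /negP h; apply/negP => /size1_polyC e; apply: h.
  have := comp_polyXaddC_K q (- c); rewrite rmorphN opprK /= e comp_polyC => <-.
  exact: size_polyC_leq1.
move=> irr [g [h [sg sh fE]]]; apply: irr.
exists (g \Po ('X - a%:P)), (h \Po ('X - a%:P)); rewrite !sz1 //.
by rewrite -rmorphM /= -fE comp_polyXaddC_K.
Qed.

Hypothesis b_pr : prime b.

(** The leading coefficients of the two factors multiply to 1, so scaling each factor by the leading
    coefficient of the other makes both monic without changing the product. *)
Lemma Zp_reducibleP (f : {poly Zp}) : f \is monic -> ~ Zp_irreducible f ->
  exists g h, [/\ g \is monic, h \is monic, (1 < size g)%N, (1 < size h)%N & f = g * h].
Proof.
move=> fm /contrapT[g [h [sg sh fE]]].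
have lgh0 : lead_coef g * lead_coef h != 0.
  apply/eqP => /(padic_mulf_eq0 b_pr)[] /eqP; rewrite lead_coef_eq0 => /eqP z.
    by rewrite z size_poly0 in sg.
  by rewrite z size_poly0 in sh.
have lgh : lead_coef g * lead_coef h = 1.
  by rewrite -lead_coef_proper_mul // -fE (monicP fm).
have lhg : lead_coef h * lead_coef g = 1 by rewrite mulrC.
have lZ c (q : {poly Zp}) : c * lead_coef q = 1 -> c *: q \is monic /\ size (c *: q) = size q.
  move=> cq; have sz : size (c *: q) = size q.
    rewrite -mul_polyC size_proper_mul ?lead_coefC ?cq ?oner_eq0 // size_polyC.
    case: eqP => [c0|_]; last by [].
    by move/eqP: cq; rewrite c0 mul0r eq_sym oner_eq0.
  by split=> //; rewrite monicE lead_coefE coefZ sz -lead_coefE cq.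
have [[gm gs] [hm hs]] := (lZ _ _ lhg, lZ _ _ lgh).
exists (lead_coef h *: g), (lead_coef g *: h); rewrite gs hs; split=> //.
by rewrite -scalerAl -scalerAr scalerA lhg scale1r.
Qed.

(* The monomial of degree [i] strictly dominates [f] for the weight, so    *)
(* [i] is a vertex of the Newton polygon; the factor collecting the roots  *)
(* of larger valuation is the limit of the iteration [g <- g + f mod g / f_i]. *)
Lemma vertex_factor A B r (f : {poly Zp}) i e eps :
    (0 < A)%N -> f \is monic -> size f = r.+1 -> (0 < i < r)%N ->
    f`_i = b%:R ^+ e * eps -> ~ pdvd 1 eps ->
    wpoly A B (A * e + B * i).+1 (f - f`_i *: 'X^i) ->
  exists g h : {poly Zp}, [/\ (1 < size g)%N, (1 < size h)%N & f = g * h].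
Proof.
move=> A0 fm fs /andP[i0 ir] fi eps1 wf.
have [|g [h [gm gs fE]]] := @factor_limit p f i; last first.
  exists g, h; split=> //; first by rewrite gs.
  have [_ ->] := size_monic_cofactor fm fs gm gs fE; lia.
(* Each round raises the weight of the error [rho] by one, while [h] stays strictly heavier than the
   dominant coefficient. *)
have iter N : exists g h rho : {poly Zp}, [/\ g \is monic, size g = i.+1, wpoly A B (B * i) g,
    wpoly A B (A * e).+1 h & [/\ wpoly A B (A * e + B * i + N).+1 rho,
    (size rho <= i)%N & f = g * ((f`_i)%:P + h) + rho]].
  elim: N => [|N [g [h [rho [gm gs wg wh [wr sr fE]]]]]].
    have [||||k [rho [E sr wk wr]]] := @wpoly_div p A B A0 i 'X^i (A * e).+1 (f - f`_i *: 'X^i).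
    - exact: monicXn.
    - exact: size_polyXn.
    - exact: wpolyXn.
    - by rewrite addSn.
    exists 'X^i, k, rho; rewrite monicXn size_polyXn; split=> //; first exact: wpolyXn.
    split=> //; first by apply: wpoly_le wr; lia.
    by rewrite mulrDr [_ * k]mulrC -addrA -E mulrC mul_polyC addrC subrK.
  (* With [s] inverse to the unit part [eps] modulo [b] and [rho = b ^ e * rho'], the polynomial
     [s * rho'] approximates [rho] divided by the dominant coefficient. *)
  have [s hs] := pdvd_not1_inv b_pr eps1.
  have [|rho' [rhoE sr']] := @pdvd_poly p e rho.
    move=> j; have [lt|le] := ltnP j i; last first.
      by rewrite nth_default ?(leq_trans sr) //; apply: pdvd0.
    have [t ht] := wr j; apply: pdvd_le; by nia.
  have wr' : wpoly A B (B * i + N).+1 rho'.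
    by apply: (@wpoly_expZ p A B e); rewrite -rhoE addnS addnA.
  pose g2 := g + s *: rho'.
  have sr2 : (size (s *: rho') < size g)%N.
    by rewrite gs ltnS (leq_trans (size_scale_leq _ _)) // (leq_trans sr').
  have g2m : g2 \is monic by rewrite monicE lead_coefDl //; exact: gm.
  have g2s : size g2 = i.+1 by rewrite size_polyDl.
  have wsr : wpoly A B (B * i + N).+1 (s *: rho').
    have := wpolyZ (pdvd0l s) wr'; by rewrite muln0.
  have wg2 : wpoly A B (B * i) g2.
    by apply: wpolyD => //; apply: wpoly_le wsr; lia.
  (* This is the error left when [g] is replaced by [g2] and the cofactor is kept. Its quotient by
     [g2] then goes into the cofactor, which brings the degree of the new error below [i]. *)
  pose err := (b%:R ^+ e * (1 - eps * s)) *: rho' - s *: rho' * h.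
  have werr : wpoly A B ((A * e + N).+2 + B * i) err.
    apply: wpolyB.
      have d : pdvd e.+1 (b%:R ^+ e * (1 - eps * s)).
        by rewrite -addn1; apply: pdvdM hs; rewrite -[_ ^+ _]mulr1; exact: pdvd_expM.
      apply: wpoly_le (wpolyZ d wr'); nia.
    apply: wpoly_le (wpolyM A0 wsr wh); lia.
  have [k [rho2 [E sr3 wk wr2]]] := wpoly_div A0 g2m g2s wg2 werr.
  exists g2, (h + k), rho2; split=> //.
    by apply: wpolyD => //; apply: wpoly_le wk; lia.
  split=> //; first by apply: wpoly_le wr2; lia.
  rewrite addrA mulrDr -addrA [g2 * k]mulrC -E {1}fE.
  rewrite /g2 /err rhoE fi mulrDl -!addrA; congr (_ + _).
  rewrite mulrDr addrAC -!addrA; rewrite addrC.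
  rewrite -!mul_polyC !rmorphM rmorphB rmorph1 rmorphM /=; ring.
(* A factor [b] weighs [A], so [A * N] rounds make the error divisible by [b ^ N]. *)
move=> N; have [g [h [rho [gm gs wg wh [wr sr fE]]]]] := iter (A * N)%N.
have [|rho' [rhoE _]] := @pdvd_poly p N rho; last first.
  by exists g, ((f`_i)%:P + h), rho'; rewrite -rhoE.
move=> j; have [lt|le] := ltnP j i; last first.
  by rewrite nth_default ?(leq_trans sr) //; apply: pdvd0.
have [t ht] := wr j; apply: pdvd_le; by nia.
Qed.

(** Otherwise the minimal weight [u] is below [r * n], and it is attained neither at degree 0 nor at
    degree [r]. The leftmost degree attaining it is then an interior vertex, where [f] splits. The
    tilted weight used for this is [r + 1] times the original one plus the degree. *)
Lemma irreducible_one_slope r n (f : {poly Zp}) :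
    f \is monic -> size f = r.+1 -> (0 < r)%N -> Zp_irreducible f -> pdvd n f`_0 ->
  wpoly r n (r * n) f.
Proof.
move=> fm fs r0 irr f0.
have [u [wu nu ub]] := wpoly_max (A := r) n r0 b_pr fm fs.
have [le|lt] := leqP (r * n) u; first exact: wpoly_le wu.
case: irr; have [i [ni li]] := wpoly_least nu.
have fr : f`_r = 1 by have := monicP fm; rewrite lead_coefE fs.
have i0 : (0 < i)%N.
  by case: i ni {li} => // -[]; exists n => //; nia.
have ir : (i < r)%N.
  rewrite ltnNge leq_eqVlt; apply/negP => /orP[/eqP ri|ri]; apply: ni.
    by apply: wt_triv; rewrite -ri; nia.
  by rewrite nth_default ?fs //; apply: wt0.
have [e [eps [fi eps1 ue]]] := wt_exact r0 b_pr (wu i) ni.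
(* Tilting the weight slightly makes the leftmost minimal monomial dominant. *)
apply: (@vertex_factor (r.+1 * r) (r.+1 * n).+1 r f i e eps) => //.
- by rewrite muln_gt0 r0.
- by rewrite i0.
- move=> j; rewrite coefB coefZ coefXn.
  have [->|ji] := eqVneq j i; first by rewrite mulr1 subrr; apply: wt0; nia.
  rewrite mulr0 subr0; have [lt'|ge] := ltnP j i.
    by have [t ht dt] := li j lt'; exists t => //; nia.
  by have [t ht dt] := wu j; exists t => //; nia.
Qed.

(** A factor of degree [s] has constant term of valuation [t] with [r * t >= m * s], and this is
    strict for [0 < s < r] because the prime [r] divides neither [m] nor [s]. Adding the bounds for
    both factors makes the valuation of the constant term of [f] exceed [m]. *)
Lemma dumas_irreducible r m (f : {poly Zp}) :
    f \is monic -> size f = r.+1 -> prime r -> (0 < m < r)%N ->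
    wpoly r m (r * m) f -> ~ pdvd m.+1 f`_0 -> Zp_irreducible f.
Proof.
move=> fm fs r_pr mr wf f0; apply: contrapT => /(Zp_reducibleP fm).
move=> [g [h [gm hm gs hs fE]]].
case gsE : (size g) gs => [|[|s]] // _.
have [_ hsE] := size_monic_cofactor fm fs gm gsE fE.
have sr : (s.+1 < r)%N by rewrite hsE in hs; lia.
have rst : (s.+1 + (r - s.+1) = r)%N by lia.
have [|wg wh] := @wpoly_factor p r m (prime_gt0 r_pr) b_pr _ _ _ _ gm hm gsE hsE.
  by rewrite rst mulnC -fE.
apply: f0; rewrite fE coef0M.
have [t ht gt] := wg 0%N; have [t' ht' ht2] := wh 0%N.
apply: pdvd_le (pdvdM gt ht2).
have nd : (m * s.+1 != r * t)%N.
  apply/eqP => e; have : (r %| m * s.+1)%N by rewrite e dvdn_mulr.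
  rewrite Euclid_dvdM // !gtnNdvd //; lia.
nia.
Qed.

(** Stretching is multiplicative, so it carries factorizations forward. Conversely, a stretched
    polynomial lies above the line of slope -1; its monic factors inherit this bound and are
    therefore stretched themselves. *)
Lemma stretch_irreducible r (f : {poly Zp}) : f \is monic -> size f = r.+1 ->
  stretch r f \is monic -> Zp_irreducible (stretch r f) <-> Zp_irreducible f.
Proof.
move=> fm fs sm; have ss := size_stretch fm fs; split=> [irr|irr].
  apply: contrapT => /(Zp_reducibleP fm)[g [h [gm hm gs hs fE]]]; apply: irr.
  case gsE : (size g) gs => [|s] // s1.
  have [_ hsE] := size_monic_cofactor fm fs gm gsE fE.
  have sr : (s <= r)%N by rewrite hsE in hs; lia.
  exists (stretch s g), (stretch (r - s) h); rewrite !size_stretch // -hsE; split=> //.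
  by rewrite -stretchM ?gsE ?hsE // subnKC // fE.
apply: contrapT => /(Zp_reducibleP sm)[g [h [gm hm gs hs fE]]]; apply: irr.
case gsE : (size g) gs => [|s] // s1.
have [_ hsE] := size_monic_cofactor sm ss gm gsE fE.
have sr : (s <= r)%N by rewrite hsE in hs; lia.
have [|wg wh] := @wpoly_factor p 1 1 isT b_pr _ _ _ _ gm hm gsE hsE.
  rewrite mul1n subnKC // -fE => j; have [jr|rj] := leqP j r; last first.
    by apply: wt_triv; lia.
  by rewrite coef_stretch //; exists (r - j)%N; [lia|apply: pdvd_expM].
rewrite !mul1n in wg wh.
have [g' [g's gE]] := unstretch gm gsE wg.
have [h' [h's hE]] := unstretch hm hsE wh.
exists g', h'; rewrite g's h's -hsE; split=> //.
apply: (@stretch_inj r); rewrite ?fs //.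
  by apply: leq_trans (size_polyMleq _ _) _; rewrite g's h's; lia.
by rewrite fE gE hE -stretchM ?g's ?h's // subnKC.
Qed.

End Factorization.

(** * Irreducible polynomials over a finite field *)

Section FieldPolynomials.
Variable F : fieldType.
Implicit Types f g h q : {poly F}.

Lemma irreducible_factor f : (1 < size f)%N ->
  exists q, [/\ q \is monic, irreducible_poly q & q %| f].
Proof.
move=> sf; pose P n := `[< exists q, [/\ size q = n, (1 < size q)%N & q %| f] >].
have ex : exists n, P n by exists (size f); apply/asboolP; exists f.
case: (ex_minnP ex) => n /asboolP[q [qn sq qf]] nmin.
have q0 : lead_coef q != 0 by rewrite lead_coef_eq0 -size_poly_gt0 ltnW.
have eqq : (lead_coef q)^-1 *: q %= q by apply: eqp_scale; rewrite invr_eq0.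
exists ((lead_coef q)^-1 *: q); split; last by rewrite (eqp_dvdl _ eqq).
  by rewrite monicE lead_coefZ mulVf.
split=> [|d d1]; first by rewrite (eqp_size eqq).
rewrite (eqp_dvdr _ eqq) => dq; apply: eqp_trans (_ : _ %= q) _; last by rewrite eqp_sym.
have sd : (0 < size d)%N.
  rewrite size_poly_gt0; apply/eqP => d0; move: dq.
  by rewrite d0 dvd0p -size_poly_eq0 -leqn0 leqNgt (ltnW sq).
rewrite -dvdp_size_eqp // eqn_leq dvdp_leq -?size_poly_gt0 ?(ltnW sq) // qn.
apply: nmin; apply/asboolP; exists d; split=> //; last exact: dvdp_trans qf.
by case: (size d) d1 sd => [|[]].
Qed.

(** Take an irreducible factor [q] with its full multiplicity [e], so that [f = u * q ^ e] with [u]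
    prime to [q]. Either [u] is nonconstant and the factorization is coprime, or [e] times the
    degree of [q] is the prime [r], leaving [e = 1] or a linear [q]. *)
Lemma prime_degree_cases r f : prime r -> f \is monic -> size f = r.+1 ->
  [\/ irreducible_poly f, exists a, f = ('X - a%:P) ^+ r
    | exists g h, [/\ g \is monic, (1 < size g)%N, (1 < size h)%N, coprimep g h
                    & f = g * h]].
Proof.
move=> r_pr fm fs.
have [|q [qm qi qf]] := @irreducible_factor f; first by rewrite fs ltnS prime_gt0.
have [sq _] := qi.
have sqe e : size (q ^+ e) = ((size q).-1 * e).+1.
  by rewrite -size_exp prednK // size_poly_gt0 expf_neq0 // monic_neq0.
have ex : exists e, q ^+ e %| f by exists 0%N; rewrite expr0 dvd1p.
have bd e : q ^+ e %| f -> (e <= r)%N.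
  move=> /dvdp_leq-/(_ (monic_neq0 fm)); rewrite fs sqe ltnS.
  by apply: leq_trans; rewrite leq_pmull // -ltnS prednK // ltnW.
case: (ex_maxnP ex bd) => e /dvdpP[u fE] emax.
have qem : q ^+ e \is monic by rewrite monic_exp.
have um : u \is monic by move: fm; rewrite fE mulrC monicMl.
have qu : ~~ (q %| u).
  apply/negP => /dvdpP[v uE]; have : q ^+ e.+1 %| f by rewrite fE uE -mulrA -exprS dvdp_mull.
  by move/emax; rewrite ltnn.
have cop : coprimep (q ^+ e) u by apply: coprimep_expl; rewrite irreducible_poly_coprime.
have e0 : (0 < e)%N by apply: emax; rewrite expr1.
have [su|su] := ltnP 1 (size u).
  apply: Or33; exists (q ^+ e), u; split=> //; last by rewrite mulrC.
  by rewrite sqe ltnS muln_gt0 e0 andbT -ltnS prednK // ltnW.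
have u1 : u = 1.
  apply/eqP; rewrite -eqp_monic ?monic1 // -size_poly_eq1 eqn_leq su.
  by rewrite size_poly_gt0 monic_neq0.
rewrite u1 mul1r in fE.
have rE : r = ((size q).-1 * e)%N by apply: succn_inj; rewrite -fs fE sqe.
have : (e %| r)%N by rewrite rE dvdn_mull.
case/primeP: (r_pr) => _ dv /dv /orP[/eqP e1|/eqP er].
  by apply: Or31; rewrite fE e1 expr1.
apply: Or32; have sq2 : size q = 2%N.
  have : ((size q).-1 * r = 1 * r)%N by rewrite mul1n [in RHS]rE er.
  by move/eqP; rewrite eqn_pmul2r ?prime_gt0 // => /eqP; case: (size q) sq => //= n _ ->.
have [a qE] : exists a, q = 'X - a%:P.
  exists (- q`_0); apply/polyP => j; rewrite coefB coefX coefC.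
  case: j => [|[|j]] /=; rewrite ?subr0 ?sub0r ?opprK //.
    by have := monicP qm; rewrite lead_coefE sq2.
  by rewrite nth_default ?sq2.
by exists a; rewrite fE er qE.
Qed.

Lemma common_root_dvdp (L : fieldType) (phi : {rmorphism F -> L}) f g x :
  irreducible_poly f -> root (map_poly phi f) x -> root (map_poly phi g) x -> f %| g.
Proof.
move=> fi rf rg; apply: contraT; rewrite -irreducible_poly_coprime // => cop.
have := coprimep_root (_ : coprimep (map_poly phi f) (map_poly phi g)) rf.
rewrite coprimep_map => /(_ cop); by rewrite -rootE rg.
Qed.

End FieldPolynomials.

(** * Counting monic irreducible polynomials of prime degree *)

Section CountIrreducible.
Variables (q r : nat).
Hypotheses (q_pr : prime q) (r_pr : prime r).
Local Notation F := 'F_q.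

Definition ffun_poly (t : {ffun 'I_r -> F}) : {poly F} :=
  'X^r + \poly_(j < r) oapp t 0 (insub j).

Lemma size_ffun_poly t : size (ffun_poly t) = r.+1.
Proof. by rewrite size_polyDl ?size_polyXn // ltnS size_poly. Qed.

Lemma ffun_poly_monic t : ffun_poly t \is monic.
Proof.
by rewrite monicE lead_coefDl ?lead_coefXn // size_polyXn ltnS size_poly.
Qed.

Lemma coef_ffun_poly t (i : 'I_r) : (ffun_poly t)`_i = t i.
Proof.
by rewrite coefD coefXn coef_poly ltn_ord valK /= ltn_eqF ?ltn_ord // add0r.
Qed.

Lemma ffun_poly_inj : injective ffun_poly.
Proof. by move=> s t e; apply/ffunP => i; rewrite -!coef_ffun_poly e. Qed.

Lemma ffun_poly_coef (f : {poly F}) : f \is monic -> size f = r.+1 ->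
  f = ffun_poly [ffun i : 'I_r => f`_i].
Proof.
move=> fm fs; apply/polyP => j; have [jr|] := ltnP j r.
  by rewrite (coef_ffun_poly _ (Ordinal jr)) ffunE.
set t := finfun _; rewrite leq_eqVlt => /orP[/eqP <-|rj]; last first.
  by rewrite !nth_default ?fs ?size_ffun_poly.
have := monicP fm; rewrite lead_coefE fs /= => ->.
by have := monicP (ffun_poly_monic t); rewrite lead_coefE size_ffun_poly.
Qed.

Definition irreducible_ffuns : {set {ffun 'I_r -> F}} :=
  [set t | `[< irreducible_poly (ffun_poly t) >]].

Lemma card_finvect (L : fieldExtType F) : #|finvect_type L| = (q ^ \dim {:L})%N.
Proof.
rewrite -(@card_vspacef F _ (Vector.class (finvect_type L : vectType F))).
by etransitivity; [apply: card_vspace | rewrite card_Fp].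
Qed.

(** A root of [f] generates an extension with [q ^ r] elements, all of which are roots of
    ['X^(q ^ r) - 'X]. *)
Lemma irreducible_dvd_genPoly (f : {poly F}) : irreducible_poly f ->
  size f = r.+1 -> f %| 'X^(q ^ r) - 'X.
Proof.
move=> fi fs; have [L dimL [z rz _]] := irredp_FAdjoin fi.
apply: (common_root_dvdp fi rz).
rewrite rmorphB /= map_polyXn map_polyX rootE !hornerE.
have := @expf_card (finvect_type L) z; rewrite card_finvect dimL fs /= => ->.
by rewrite subrr.
Qed.

Lemma card_roots_irreducible (K : finFieldType) (phi : {rmorphism F -> K})
    (f : {poly F}) : #|K| = (q ^ r)%N -> irreducible_poly f ->
  size f = r.+1 -> #|[set x | root (map_poly phi f) x]| = r.
Proof.
move=> cK fi fs.
have : map_poly phi f %| \prod_(x : K) ('X - x%:P).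
  rewrite -finField_genPoly cK -(map_polyXn phi) -(map_polyX phi) -rmorphB.
  by rewrite dvdp_map irreducible_dvd_genPoly.
move=> /dvdp_prod_XsubC[m fm].
have um : uniq (mask m (index_enum K)) by rewrite mask_uniq // index_enum_uniq.
apply: succn_inj; rewrite -fs -(size_map_poly phi) (eqp_size fm).
rewrite size_prod_XsubC -(card_uniqP um); congr (_.+1); apply: eq_card => x.
by rewrite inE (eqp_root fm) root_prod_XsubC.
Qed.

(** Double count pairs of an irreducible polynomial and a root in the field with [q ^ r] elements.
    Each polynomial has [r] roots there. An element outside the prime field is a root of exactly one
    polynomial, its minimal polynomial, whose degree divides the prime [r]; elements of the prime
    field are roots of none. *)
Lemma card_irreducible_ffuns : (#|irreducible_ffuns| * r = q ^ r - q)%N.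
Proof.
have [Fm qF cF] := pPrimePowerField q_pr (prime_gt0 r_pr).
(* The same field under two structures: an extension of [F] for minimal polynomials, and a finite
   field for counting. *)
pose K : fieldExtType F := pPrimeCharType qF.
pose KT : finFieldType := pPrimeCharType qF.
pose phi : {rmorphism F -> KT} := in_alg K.
have dimK : \dim {:K} = r.
  rewrite pprimeChar_dimf -[#|_|]/#|Fm| cF lognX lognE q_pr prime_gt0 // dvdnn.
  by rewrite divnn prime_gt0 // logn1 muln1.
pose P t (x : KT) := (t \in irreducible_ffuns) && root (map_poly phi (ffun_poly t)) x.
have fibers (x : KT) : (\sum_(t | P t x) 1 = ((x : K) \notin 1%VS))%N.
  case: (boolP ((x : K) \in 1%VS)) => [/vlineP[a xE]|x1].
    apply: big1 => t /andP[]; rewrite inE => /asboolP ti.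
    have -> : x = phi a by rewrite xE.
    rewrite fmorph_root root_factor_theorem => h.
    have := ti.2 ('X - a%:P); rewrite size_XsubC => /(_ isT h) /eqp_size.
    rewrite size_XsubC size_ffun_poly => -[r1].
    by have := prime_gt1 r_pr; rewrite -r1.
  have /polyOver1P[g gE] := minPolyOver 1%AS (x : K).
  have gm : g \is monic by rewrite -(map_monic (in_alg K)) -gE monic_minPoly.
  have gs : size g = r.+1.
    rewrite -(size_map_poly (in_alg K)) -gE size_minPoly; congr _.+1.
    have := dim_Fadjoin 1%AS (x : K); rewrite dimv1 muln1 => dE.
    have := field_dimS (subvf <<1%AS; (x : K)>>%AS); rewrite dE dimK.
    case/primeP: (r_pr) => _ dv /dv /orP[|/eqP//].
    by rewrite adjoin_deg_eq1 (negPf x1).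
  have gi : irreducible_poly g.
    split=> [|h h1 hg]; first by rewrite gs ltnS prime_gt0.
    have : map_poly (in_alg K) h %| minPoly 1%AS (x : K) by rewrite gE dvdp_map.
    have ho : map_poly (in_alg K) h \is a polyOver 1%AS by apply/polyOver1P; exists h.
    move=> /(minPoly_irr ho) /orP[]; first by rewrite gE eqp_map.
    by move/eqp_size; rewrite size_map_poly size_poly1 => e; rewrite e in h1.
  have rg : root (map_poly phi g) x.
    have := root_minPoly 1%AS (x : K); by rewrite gE.
  rewrite (big_pred1 [ffun i : 'I_r => g`_i]) // => t.
  apply/andP/eqP => [[]|->]; rewrite inE.
    move=> /asboolP ti rt; apply: ffun_poly_inj; rewrite -ffun_poly_coef //.
    apply/eqP; rewrite -eqp_monic ?ffun_poly_monic // -dvdp_size_eqp.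
      by rewrite size_ffun_poly gs.
    exact: common_root_dvdp ti rt rg.
  by rewrite -ffun_poly_coef //; split=> //; apply/asboolP.
have : (\sum_(t in irreducible_ffuns) \sum_(x : KT | P t x) 1 = q ^ r - q)%N.
  rewrite (exchange_big_dep xpredT) //=.
  rewrite (eq_bigr (fun x : KT => ((x : K) \notin 1%VS) : nat)); last first.
    move=> x _; rewrite -fibers; apply: eq_bigl => t.
    by rewrite /P; case: (t \in _).
  rewrite -[RHS](_ : #|KT| - #|[pred x : KT | (x : K) \in 1%VS]| = _)%N.
    rewrite -(cardC [pred x : KT | (x : K) \in 1%VS]) addKn -sum1_card [RHS]big_mkcond.
    by apply: eq_bigr => x _; rewrite inE; case: (_ \in _).
  have -> : #|KT| = #|Fm| by [].
  rewrite cF; congr (_ - _)%N.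
  by etransitivity; [apply: (@card_vspace1 F KT (Falgebra.class K))|rewrite card_Fp].
rewrite -sum1_card big_distrl /= => <-; apply: eq_bigr => t tS.
rewrite mul1n; move: (tS); rewrite inE => /asboolP ti.
rewrite -[LHS](@card_roots_irreducible KT phi (ffun_poly t)) ?size_ffun_poly //.
by rewrite -sum1_card; apply: eq_bigl => x; rewrite inE /P tS.
Qed.

End CountIrreducible.

(** * Reduction modulo p *)

Section Hensel.
Variable p : nat.
Local Notation Zp := (padic_int p).
Local Notation b := (padic_base p).
Local Notation red := (map_poly (@padic_residue p)).
Local Notation lift := (map_poly (@padic_lift p)).
Hypothesis b_pr : prime b.

Lemma residue_expn k (x : Zp) : (0 < k)%N -> padic_residue (b%:R ^+ k * x) = 0.
Proof. by move=> k0; apply/(padic_residue_eq0 b_pr)/(pdvd_le k0)/pdvd_expM. Qed.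

Lemma red_expn k (P : {poly Zp}) : (0 < k)%N -> red (b%:R ^+ k *: P) = 0.
Proof.
by move=> k0; apply/polyP => j; rewrite coef_map coefZ coef0 /= residue_expn.
Qed.

Lemma red_eq0 (P : {poly Zp}) : red P = 0 ->
  exists Q : {poly Zp}, P = b%:R *: Q /\ (size Q <= size P)%N.
Proof.
move=> h; have [|Q [E s]] := @pdvd_poly p 1 P; last by exists Q.
by move=> j; apply/(padic_residue_eq0 b_pr); rewrite -coef_map h coef0.
Qed.

Lemma size_red (P : {poly Zp}) : P \is monic -> size (red P) = size P.
Proof.
by move=> Pm; rewrite size_map_poly_id0 // (monicP Pm) rmorph1 oner_eq0.
Qed.

Lemma liftK (u : {poly 'F_b}) : red (lift u) = u.
Proof.
by apply/polyP => j; rewrite coef_map /= coef_map_id0 // padic_liftK.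
Qed.

Lemma size_lift (u : {poly 'F_b}) : size (lift u) = size u.
Proof. exact: (size_map_inj_poly (can_inj (@padic_liftK p))). Qed.

Lemma lift_monic (u : {poly 'F_b}) : u \is monic -> lift u \is monic.
Proof.
move=> um; rewrite monicE lead_coefE size_lift coef_map_id0 //.
by rewrite -lead_coefE (monicP um).
Qed.

(** Monic factors keep their degrees under reduction, so a factorization of [f] would reduce to a
    proper one. *)
Lemma residue_irreducible (f : {poly Zp}) :
  f \is monic -> irreducible_poly (red f) -> Zp_irreducible f.
Proof.
move=> fm [_ fi]; apply: contrapT => /(Zp_reducibleP b_pr fm).
move=> [g [h [gm hm gs hs fE]]].
have := fi (red g); rewrite size_red // gtn_eqF // => /(_ isT).
rewrite fE rmorphM dvdp_mulr //= => /(_ isT) /eqp_size.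
rewrite size_monicM ?monic_map ?monic_neq0 ?monic_map // !size_red //.
by case: (size g) gs (size h) hs => // n _ [|[|m]] //= _; lia.
Qed.

(** Linear lifting: each round improves the precision by one power of [b] with fixed reductions of
    both factors; compactness then supplies the exact factor. *)
Lemma hensel (f : {poly Zp}) (g0 h0 : {poly 'F_b}) n :
    red f = g0 * h0 -> g0 \is monic -> size g0 = n.+1 -> coprimep g0 h0 ->
  exists g h : {poly Zp}, [/\ g \is monic, size g = n.+1 & f = g * h].
Proof.
move=> fE g0m g0s /Bezout_eq1_coprimepP[[u v] /= uv].
have step N : exists g h rho : {poly Zp}, [/\ g \is monic, red g = g0, red h = h0
    & f = g * h + b%:R ^+ N.+1 *: rho].
  elim: N => [|N [g [h [rho [gm gE hE E]]]]].
    have [|rho [rE _]] := @red_eq0 (f - lift g0 * lift h0).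
      by rewrite rmorphB rmorphM /= !liftK fE subrr.
    exists (lift g0), (lift h0), rho; rewrite !liftK lift_monic // expr1 -rE.
    by rewrite addrC subrK.
  (* The Bezout relation makes [d0 * h0] congruent to the error modulo [g0]; reducing [d0] modulo
     [g0] keeps the corrected factor monic of the same degree. *)
  pose d0 := (v * red rho) %% g0; pose d := lift d0.
  have gs : size g = n.+1 by rewrite -g0s -gE size_red.
  have ds : (size (b%:R ^+ N.+1 *: d) < size g)%N.
    rewrite (leq_ltn_trans (size_scale_leq _ _)) // size_lift gs -g0s.
    by rewrite ltn_modp monic_neq0.
  pose g2 := g + b%:R ^+ N.+1 *: d.
  have g2m : g2 \is monic by rewrite monicE lead_coefDl //; exact: gm.
  have g2E : red g2 = g0 by rewrite rmorphD /= red_expn // addr0.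
  pose rho1 := rho - d * h.
  pose k := Pdiv.Ring.rdivp rho1 g2; pose rho2 := Pdiv.Ring.rmodp rho1 g2.
  have r1E : rho1 = k * g2 + rho2 := Pdiv.RingMonic.rdivp_eq g2m rho1.
  have r1g : g0 %| red rho1.
    have d0E : d0 = v * red rho - (v * red rho) %/ g0 * g0.
      by rewrite [X in X - _](divp_eq _ g0) addrC addKr.
    rewrite rmorphB rmorphM /= liftK hE d0E.
    have -> : red rho - (v * red rho - (v * red rho) %/ g0 * g0) * h0
      = (u * red rho + (v * red rho) %/ g0 * h0) * g0.
      rewrite -[X in X - _]mul1r -uv; ring.
    exact: dvdp_mull.
  (* The reduced remainder is divisible by [g0] but has smaller degree, which gains the next power
     of [b]. *)
  have r2 : red rho2 = 0.
    apply/eqP; apply: contraT => nz.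
    have : g0 %| red rho2.
      move: r1g; rewrite r1E rmorphD rmorphM /= g2E.
      by rewrite dvdp_addr // dvdp_mull.
    move=> /dvdp_leq-/(_ nz); rewrite leqNgt => /negP[].
    rewrite -g2E (size_red g2m); apply: leq_ltn_trans (size_poly _ _) _.
    by rewrite Pdiv.Ring.ltn_rmodp monic_neq0.
  have [rho3 [r3E _]] := red_eq0 r2.
  exists g2, (h + b%:R ^+ N.+1 *: k), rho3; split=> //.
    by rewrite rmorphD /= red_expn // addr0.
  rewrite [b%:R ^+ N.+2]exprSr -scalerA -r3E.
  have -> : rho2 = rho - d * h - k * g2 by rewrite -/rho1 r1E addrC addKr.
  rewrite {1}E /g2 -!mul_polyC; ring.
apply: (@factor_limit p) => N; have [g [h [rho [gm gE hE E]]]] := step N.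
exists g, h, (b%:R *: rho); split=> //; first by rewrite -g0s -gE size_red.
by rewrite E exprSr scalerA.
Qed.

Lemma irreducible_residue_cases r (f : {poly Zp}) :
    prime r -> f \is monic -> size f = r.+1 -> Zp_irreducible f ->
  irreducible_poly (red f) \/ exists a, red f = ('X - a%:P) ^+ r.
Proof.
move=> r_pr fm fs irr.
have [||i|i|[g [h [gm gs hs cop fE]]]] := @prime_degree_cases _ r (red f) r_pr.
- by rewrite monic_map.
- by rewrite size_red.
- by left.
- by right.
case gsE : (size g) gs => [|n] // gs.
have [g' [h' [gm' gs' fE']]] := hensel fE gm gsE cop.
have [hm' hs'] := size_monic_cofactor fm fs gm' gs' fE'.
case: irr; exists g', h'; rewrite gs'; split=> //.
have hm : h \is monic by rewrite -(monicMl h gm) -fE monic_map.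
have : ((size g + size h).-1 = r.+1)%N.
  by rewrite -size_monicM ?monic_neq0 // -fE size_red.
rewrite gsE hs' ltnS subn_gt0 addSn /= => e.
by rewrite -ltnS -e -addn1 ltn_add2l.
Qed.

End Hensel.

(** * Volume of clopen sets *)

Section Volume.
Variables (R : realType) (p n : nat).
Local Notation Zp := (padic_int p).
Local Notation b := (padic_base p).
Local Notation V := ('I_n -> Zp).
Implicit Types (A B : set V) (v w : R).

Definition count_mod k A := #|[set t | `[< A (@vec_lift p n k t) >]]|.

(* Content of a clopen set, read off from its number of residues modulo [b ^ k]. *)
Definition has_volume A v := exists k0, forall k, (k0 <= k)%N ->
  is_level k A /\ (count_mod k A)%:R = v * (b ^ (n * k))%:R.

Lemma is_level_lift k A c : is_level k A -> A (vec_lift (vec_mod k c)) <-> A c.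
Proof.
move=> lA; split; apply: lA; first exact: agree_lift_mod.
exact/agree_sym/agree_lift_mod.
Qed.

Lemma expb_gt0 k : (0 : R) < (b ^ k)%:R.
Proof. by rewrite ltr0n expn_gt0 padic_base_gt0. Qed.

Lemma has_volume_ext A B v : (forall c, A c <-> B c) -> has_volume A v -> has_volume B v.
Proof. by move=> h; rewrite (_ : A = B) //; apply/predeqP. Qed.

Lemma has_volume0 : has_volume (fun=> False) 0.
Proof.
exists 0%N => k _; split=> //; rewrite mul0r /count_mod (_ : [set _ | _] = finset.set0) ?cards0 //.
by apply/setP => t; rewrite !inE; apply/asboolP.
Qed.

Lemma has_volumeT : has_volume (fun=> True) 1.
Proof.
exists 0%N => k _; split=> //; rewrite mul1r /count_mod (_ : [set _ | _] = [set: _]).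
  by rewrite cardsT card_ffun !card_ord -expnM mulnC.
by apply/setP => t; rewrite !inE; apply/asboolP.
Qed.

Lemma has_volumeU A B v w : (forall c, A c -> ~ B c) ->
  has_volume A v -> has_volume B w -> has_volume (fun c => A c \/ B c) (v + w).
Proof.
move=> dAB [k hA] [l hB]; exists (maxn k l) => m; rewrite geq_max => /andP[km lm].
have [[lA cA] [lB cB]] := (hA m km, hB m lm); split.
  by move=> c d cd [/(lA _ _ cd)|/(lB _ _ cd)]; [left|right].
rewrite mulrDl -cA -cB -natrD /count_mod -cardsUI.
rewrite (_ : _ :&: _ = finset.set0) ?cards0 ?addn0; last first.
  by apply/setP => t; rewrite !inE; apply/andP => -[/asboolP/dAB h /asboolP].
by congr (#|pred_of_set _|%:R); apply/setP => t; rewrite !inE asbool_or.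
Qed.

Lemma has_volumeD A B v w : (forall c, B c -> A c) ->
  has_volume A v -> has_volume B w -> has_volume (fun c => A c /\ ~ B c) (v - w).
Proof.
move=> BA [k hA] [l hB]; exists (maxn k l) => m; rewrite geq_max => /andP[km lm].
have [[lA cA] [lB cB]] := (hA m km, hB m lm); split.
  by move=> c d cd [Ac nB]; split; [apply: lA Ac|move=> /(lB _ _ (agree_sym cd))].
have sBA : [set t | `[< B (@vec_lift p n m t) >]] \subset [set t | `[< A (vec_lift t) >]].
  by apply/fintype.subsetP => t; rewrite !finset.in_set => /asboolP Bt; apply/asboolP/BA.
rewrite mulrBl -cA -cB -natrB ?subset_leq_card //.
rewrite /count_mod -(finset.setIidPr sBA) -cardsD.
congr (#|pred_of_set _|%:R); apply/setP => t.
by rewrite !inE asbool_and asbool_neg andbC.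
Qed.

Lemma has_volume_bigU (I : eqType) (s : seq I) (F : I -> set V) (v : I -> R) :
    uniq s -> (forall i, i \in s -> has_volume (F i) (v i)) ->
    (forall i j c, i \in s -> j \in s -> F i c -> F j c -> i = j) ->
  has_volume (fun c => exists2 i, i \in s & F i c) (\sum_(i <- s) v i).
Proof.
elim: s => [|i s IH] /=.
  by move=> _ _ _; rewrite big_nil; apply: has_volume_ext has_volume0 => c; split=> // -[].
move=> /andP[nis us] hF dF; rewrite big_cons.
have h : has_volume (fun c => exists2 i, i \in s & F i c) (\sum_(i <- s) v i).
  apply: IH => // [j js|j k c js ks]; first by apply: hF; rewrite inE js orbT.
  by apply: dF; rewrite inE ?js ?ks orbT.
apply: has_volume_ext (has_volumeU _ (hF i (mem_head _ _)) h) => [c|c Fi [j js Fj]].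
  split=> [[Fi|[j js Fj]]|[j]]; first by exists i; rewrite ?mem_head.
    by exists j; rewrite // inE js orbT.
  rewrite inE => /orP[/eqP -> Fi|js Fj]; [by left|by right; exists j].
have ij : i = j by apply: dF Fi Fj; rewrite inE ?eqxx // js orbT.
by rewrite ij js in nis.
Qed.

(** A bijection that preserves congruences in both directions permutes the residue vectors modulo
    each [b ^ k]. *)
Lemma has_volume_isometry (f g : V -> V) A v :
    (forall k c d, agree k c d -> agree k (f c) (f d)) ->
    (forall k c d, agree k c d -> agree k (g c) (g d)) ->
    cancel f g -> cancel g f ->
  has_volume A v -> has_volume (fun c => A (f c)) v.
Proof.
move=> fa ga fK gK [k0 hA]; exists k0 => k /hA[lA cA]; split.
  by move=> c d /fa; apply: lA.
rewrite -cA /count_mod; congr (_%:R).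
pose F t := vec_mod k (f (@vec_lift p n k t)).
pose G t := vec_mod k (g (@vec_lift p n k t)).
have FK : cancel F G.
  move=> t; rewrite -[RHS](vec_liftK t); apply/vec_mod_eq.
  by rewrite -[X in agree _ _ X]fK; apply/ga/agree_lift_mod.
have GK : cancel G F.
  move=> t; rewrite -[RHS](vec_liftK t); apply/vec_mod_eq.
  by rewrite -[X in agree _ _ X]gK; apply/fa/agree_lift_mod.
rewrite -[RHS](on_card_preimset (f := F)); last by apply: onW_bij; exists G.
apply: eq_card => t; rewrite !inE /F; apply/asboolP/asboolP => h.
  exact/(is_level_lift _ lA).
exact/(is_level_lift _ lA).
Qed.

Lemma card_residue_class m d q N : (q = m * d)%N -> (N < m)%N ->
  #|[pred x : 'I_q | x %% m == N]%N| = d.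
Proof.
move=> qE Nm.
have hlt (y : 'I_d) : (y * m + N < q)%N.
  rewrite qE; apply: (@leq_trans (y.+1 * m)); first by rewrite mulSnr ltn_add2l.
  by rewrite mulnC leq_mul2l ltn_ord orbT.
rewrite -[RHS](card_ord d) -(card_imset (f := fun y => Ordinal (hlt y))).
  apply: eq_card => x; rewrite inE; apply/eqP/imsetP => [xN|[y _ ->]]; last first.
    by rewrite /= modnMDl modn_small.
  have m0 : (0 < m)%N by case: (m) Nm.
  have xd : (x %/ m < d)%N by rewrite ltn_divLR // mulnC -qE.
  by exists (Ordinal xd) => //; apply: val_inj; rewrite /= -xN -divn_eq.
move=> y y' /(congr1 val) /= /eqP; rewrite eqn_add2r eqn_pmul2r.
  by move=> /eqP h; apply: val_inj.
by case: (m) Nm.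
Qed.

(** On residues modulo [b ^ k], multiplication by [b ^ e i] in coordinate [i] has fibers that are
    products of residue classes modulo [b ^ (k - e i)], so each fiber has [b ^ (\sum_i e i)]
    elements. *)
Lemma has_volume_scale (e : 'I_n -> nat) A v : has_volume A v ->
  has_volume (fun c => exists2 a, A a & forall i, c i = b%:R ^+ e i * a i)
    (v / (b ^ (\sum_i e i))%:R).
Proof.
move=> [k0 hA]; set S := (X in has_volume X).
(* This keeps every [k - e i] at least [k0], so that dividing out [b ^ e i] still leaves enough
   digits to decide membership in [A]. *)
exists (k0 + \sum_i e i)%N => k hk.
have ek i : (k0 + e i <= k)%N.
  by apply: leq_trans hk; rewrite leq_add2l (bigD1 i) //= leq_addr.
have [lA cA] := hA k (leq_trans (leq_addr _ _) hk).
have [lA0 _] := hA k0 (leqnn _).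
have near a d : A a -> (forall i, pdvd k (b%:R ^+ e i * d i - b%:R ^+ e i * a i)) -> A d.
  move=> Aa h; apply: lA0 Aa; apply/agree_sym/agreeP => i.
  have := h i; rewrite -mulrBr => hi; apply: (@pdvd_le _ _ (k - e i)).
    by have := ek i; lia.
  by apply: (@pdvd_expM2l _ (e i)); rewrite subnKC //; have := ek i; lia.
have lS : is_level k S.
  move=> c d /agreeP cd [a Aa ca].
  have /choice[a' a'E] i : exists y, d i = b%:R ^+ e i * y.
    have : pdvd (e i) (d i); last by move=> [y ->]; exists y.
    have -> : d i = c i - (c i - d i) by rewrite opprB addrC subrK.
    apply: pdvdB; first by rewrite ca; apply: pdvd_expM.
    by apply: pdvd_le (cd i); have := ek i; lia.
  exists a' => //; apply: (near a) => // i; rewrite -a'E -ca -opprB.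
  exact: pdvdN.
split=> //.
pose f (t : {ffun 'I_n -> 'I_(b ^ k)}) := vec_mod k (fun i => b%:R ^+ e i * vec_lift t i).
have cE : (count_mod k A = count_mod k S * b ^ (\sum_i e i))%N.
  rewrite /count_mod -sum1_card.
  rewrite (partition_big f [in [set t | `[< S (vec_lift t) >]]]) /=; last first.
    move=> t; rewrite !finset.in_set => /asboolP At; apply/asboolP/is_level_lift => //.
    by exists (vec_lift t).
  rewrite -[X in (X * _)%N]sum1_card big_distrl /=; apply: eq_bigr => s.
  rewrite finset.in_set mul1n => /asboolP[a Aa sa].
  pose Q i := [pred x : 'I_(b ^ k) | x %% b ^ (k - e i) == `|pdigits (a i) (k - e i)|]%N.
  have QE i (x : 'I_(b ^ k)) : Q i x <-> pdvd k (b%:R ^+ e i * x%:R - b%:R ^+ e i * a i).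
    have -> : pdvd k (b%:R ^+ e i * x%:R - b%:R ^+ e i * a i) <-> pdvd (k - e i) (x%:R - a i).
      rewrite -mulrBr; have eki : (e i + (k - e i) = k)%N by have := ek i; lia.
      split=> [h|[y ->]]; first by apply: (@pdvd_expM2l _ (e i)); rewrite eki.
      by rewrite mulrA -exprD eki; apply: pdvd_expM.
    rewrite -pdigits_eq pdigits_nat /Q /= /pmodulus modz_nat.
    split=> [/eqP ->|h]; first by rewrite gez0_abs // pdigits_ge0.
    by apply/eqP; rewrite -h.
  rewrite (eq_bigl (fun t => t \in family Q)).
    transitivity (\prod_i \sum_(x in Q i) 1)%N.
      rewrite bigA_distr_big_dep /=; apply: eq_bigr => t _; by rewrite big1.
    rewrite expn_sum; apply: eq_bigr => i _; rewrite sum1_card.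
    apply: card_residue_class; last exact: pdigits_ltn.
    by rewrite -expnD; congr (_ ^ _)%N; have := ek i; lia.
  move=> t; rewrite finset.in_set; apply/andP/familyP => [[_ /eqP ft] i|h].
    apply/QE; rewrite -sa; apply/pdigits_eq.
    by rewrite -[X in vec_lift X]ft; apply: esym; apply: agree_lift_mod.
  have {}h i : pdvd k (b%:R ^+ e i * vec_lift t i - b%:R ^+ e i * a i) by apply/QE/h.
  split; first by apply/asboolP; apply: near h.
  apply/eqP; rewrite -[RHS](vec_liftK s); apply/vec_mod_eq/agreeP => i.
  by rewrite sa.
apply: (mulIf (lt0r_neq0 (expb_gt0 (\sum_i e i)))).
rewrite -natrM -cE cA mulrAC divfK // lt0r_neq0 //; exact: expb_gt0.
Qed.

Lemma has_volume_ball (a : V) k : has_volume (padic_ball a k) (ball_volume R p n k).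
Proof.
have h := has_volume_scale (fun=> k) has_volumeT.
rewrite sum_nat_const card_ord mul1r in h.
apply: has_volume_ext (@has_volume_isometry (fun c i => c i - a i)
  (fun c i => c i + a i) _ _ _ _ _ _ h).
- move=> c; split=> [[d _ E] i|h' ].
    by apply/pdigits_eq; exists (d i); rewrite -E.
  have /choice[d dE] i : exists y, c i - a i = b%:R ^+ k * y by apply/pdigits_eq/h'.
  by exists d.
- move=> l c d /agreeP cd; apply/agreeP => i.
  by rewrite opprB addrA subrK.
- move=> l c d /agreeP cd; apply/agreeP => i.
  by rewrite opprD addrACA subrr addr0.
- by move=> c; apply: funext => i; rewrite subrK.
- by move=> c; apply: funext => i; rewrite addrK.
Qed.

(** The union bound, for residues counted at one level [L] fine enough for [A] and all the sets of
    the cover. *)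
Lemma has_volume_cover A v (F : nat -> set V) (w : nat -> R) M :
    has_volume A v -> (forall m, has_volume (F m) (w m)) ->
    (forall c, A c -> exists2 m, (m < M)%N & F m c) ->
  v <= \sum_(m < M) w m.
Proof.
move=> [k0 hA] /choice[K hF] cov.
pose L := (k0 + \sum_(m < M) K m)%N.
have [_ cA] := hA L (leq_addr _ _).
rewrite -(ler_pM2r (expb_gt0 (n * L))) -cA mulr_suml.
have cF (m : 'I_M) : w m * (b ^ (n * L))%:R = (count_mod L (F m))%:R.
  have Lm : (K m <= L)%N by rewrite /L (bigD1 m) //= addnCA leq_addr.
  by have [_ ->] := hF m L Lm.
rewrite (eq_bigr _ (fun m _ => cF m)) -natr_sum ler_nat /count_mod.
apply: (@leq_trans #|\bigcup_(m < M) [set t | `[< F m (@vec_lift p n L t) >]]|).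
  apply/subset_leq_card/fintype.subsetP => t; rewrite finset.in_set => /asboolP /cov[m mM Fm].
  by apply/finset.bigcupP; exists (Ordinal mM) => //; rewrite finset.in_set; apply/asboolP.
elim/big_rec2: _ => [|m x y _ h]; first by rewrite cards0.
by apply: leq_trans (leq_card_setU _ _) _; rewrite leq_add2l.
Qed.

End Volume.

(** * Comparison of volumes with the Haar outer measure *)

Section Haar.
Variables (R : realType) (p n : nat).
Local Notation Zp := (padic_int p).
Local Notation b := (padic_base p).
Local Notation V := ('I_n -> Zp).
Implicit Types (A S : set V) (v w : R).

Lemma ball_volume_ge0 k : 0 <= ball_volume R p n k.
Proof. by rewrite invr_ge0 ler0n. Qed.

Lemma haar_measure_le A S : (forall c, A c -> S c) ->
  (@haar_measure R p n A <= @haar_measure R p n S)%E.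
Proof.
move=> AS; apply: le_ereal_inf => _ [a [k [cov ->]]].
by exists a, k; split=> // c /AS /cov.
Qed.

(** By compactness a countable cover by balls has a finite subcover, to which the union bound
    applies. Without one, the points of [A] outside the first [M] balls would form decreasing
    nonempty clopen sets with a common point, which no ball covers. *)
Lemma haar_measure_ge A v : has_volume A v -> (v%:E <= @haar_measure R p n A)%E.
Proof.
move=> hA; apply: le_ereal_inf_tmp => _ [a [k [cov ->]]].
have [M MP] : exists M, forall c, A c -> exists2 m, (m < M)%N & padic_ball (a m) (k m) c.
  have [k0 /(_ k0 (leqnn _))[lA _]] := hA.
  apply: contrapT => /forallNP no.
  have [||M|x xP] := @padic_compact p n (fun M => k0 + \sum_(m < M) k m)%N
    (fun M c => A c /\ forall m, (m < M)%N -> ~ padic_ball (a m) (k m) c).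
  - move=> M c d cd [Ac nc]; split; first by apply: (is_level_le _ lA) cd Ac; apply: leq_addr.
    move=> m mM md; apply: (nc m mM) => i; rewrite -md.
    apply: (agree_le _ cd); rewrite (bigD1 (Ordinal mM)) //= addnCA; exact: leq_addr.
  - by move=> M c [Ac nc]; split=> // m mM; apply: nc; apply: ltnW.
  - have /existsNP[c /not_implyP[Ac nc]] := no M; exists c; split=> // m mM mc.
    by apply: nc; exists m.
  have [m _ xm] := cov x (xP 0%N).1.
  exact: (xP m.+1).2 m (ltnSn m) xm.
have := has_volume_cover hA (fun m => has_volume_ball R (a m) (k m)) MP.
rewrite -lee_fin => /le_trans; apply.
rewrite -sumEFin -(big_mkord xpredT (fun m => (ball_volume R p n (k m))%:E)).
by apply: nneseries_lim_ge => m _ _; rewrite lee_fin ball_volume_ge0.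
Qed.

Lemma sum_half_pow M : \sum_(0 <= m < M) ((2 ^ m)%:R : R)^-1 <= 2.
Proof.
suff -> : \sum_(0 <= m < M) ((2 ^ m)%:R : R)^-1 = 2 - 2 / (2 ^ M)%:R.
  by rewrite gerBl divr_ge0 ?ler0n.
elim: M => [|M IH]; first by rewrite big_geq // expn0 divr1 subrr.
rewrite big_nat_recr //= IH expnS natrM invfM.
have : (2 ^ M)%:R != 0 :> R by rewrite pnatr_eq0 expn_eq0.
set x := (2 ^ M)%:R; move=> x0; field.
by rewrite x0.
Qed.

(** The residue classes making up [A] cover it at total volume [v]. A cover is an infinite sequence
    of balls, so it is padded with balls of total volume at most [eps]; positive dimension allows
    balls that small. *)
Lemma haar_measure_clopen_le A v : (0 < n)%N -> has_volume A v ->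
  (@haar_measure R p n A <= v%:E)%E.
Proof.
move=> n0 [k0 /(_ k0 (leqnn _))[lA cA]].
apply/lee_addgt0Pr => eps eps0.
pose T := [set t | `[< A (@vec_lift p n k0 t) >]].
pose N := #|T|.
(* The padding ball of index [m] has volume at most [2 ^- (L + m)], and these volumes sum to at most
   [2 / 2 ^ L]. *)
pose L := Num.bound (2 / eps).
have Leps : 2 / (2 ^ L)%:R <= eps.
  rewrite ler_pdivrMr ?ltr0n ?expn_gt0 // mulrC -ler_pdivrMr //.
  apply: ltW; apply: lt_trans (archi_boundP _) _; first by rewrite divr_ge0 // ltW.
  by rewrite ltr_nat ltn_expl.
pose a m : V := if (m < N)%N then nth (fun=> 0) [seq vec_lift t | t <- enum T] m else fun=> 0.
pose k m := if (m < N)%N then k0 else (L + m)%N.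
apply: (@le_trans _ _ (\sum_(0 <= m <oo) (ball_volume R p n (k m))%:E)%E).
  apply: ereal_inf_lbound; exists a, k; split=> // c Ac.
  pose t := vec_mod k0 c.
  have tT : t \in enum T.
    by rewrite mem_enum finset.in_set; apply/asboolP/(is_level_lift _ lA).
  have tN : (index t (enum T) < N)%N by rewrite /N cardE index_mem.
  exists (index t (enum T)) => //= i; rewrite /k /a tN.
  rewrite (nth_map t) ?index_mem // nth_index //.
  by apply: esym; apply: agree_lift_mod.
apply: lime_le; first by apply: is_cvg_nneseries => m _ _; rewrite lee_fin ball_volume_ge0.
near=> M.
rewrite sumEFin -EFinD lee_fin.
apply: (@le_trans _ _ (\sum_(0 <= m < M) ((if (m < N)%N then ball_volume R p n k0 else 0)
   + ((2 ^ L)%:R)^-1 * ((2 ^ m)%:R)^-1))).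
  apply: ler_sum => m _; rewrite /k; case: ifP => _.
    by rewrite lerDl mulr_ge0 // invr_ge0 ler0n.
  rewrite add0r -invfM -natrM -expnD /ball_volume lef_pV2 ?posrE ?ltr0n ?expn_gt0 ?padic_base_gt0 //.
  rewrite ler_nat; apply: (@leq_trans (b ^ (L + m))).
    by case: (L + m)%N => // j; rewrite leq_exp2r // padic_base_gt1.
  by rewrite leq_exp2l ?padic_base_gt1 // leq_pmull.
rewrite big_split /=; apply: lerD; last first.
  rewrite -mulr_sumr; apply: le_trans Leps; rewrite [2 / _]mulrC.
  by apply: ler_wpM2l; [rewrite invr_ge0 ler0n|apply: sum_half_pow].
have -> : v = N%:R * ball_volume R p n k0.
  rewrite [N%:R]cA /ball_volume mulfK // pnatr_eq0 -lt0n expn_gt0.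
  by rewrite padic_base_gt0.
have -> : \sum_(0 <= m < M) (if (m < N)%N then ball_volume R p n k0 else 0)
    = (minn M N)%:R * ball_volume R p n k0.
  elim: (M) => [|M' IH]; first by rewrite big_geq // min0n mul0r.
  rewrite big_nat_recr //= IH; case: ltnP => h.
    by rewrite !(minn_idPl _) // 1?ltnW // -natr1 mulrDl mul1r.
  by rewrite !(minn_idPr _) ?addr0 // leqW.
by rewrite ler_wpM2r ?ball_volume_ge0 // ler_nat geq_minr.
Unshelve. all: by end_near.
Qed.

Lemma haar_measure_sandwich S x : (0 < n)%N ->
    (forall eps, 0 < eps -> exists A U v w,
       [/\ has_volume A v, has_volume U w, forall c, A c -> S c,
           forall c, S c -> U c & x - eps <= v /\ w <= x + eps]) ->
  @haar_measure R p n S = x%:E.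
Proof.
move=> n0 H; apply/eqP; rewrite eq_le; apply/andP; split; apply/lee_addgt0Pr => eps.
  move=> /H[A [U [v [w [_ hU _ SU [_ wx]]]]]].
  apply: le_trans (haar_measure_le SU) _.
  by apply: le_trans (haar_measure_clopen_le n0 hU) _; rewrite -EFinD lee_fin.
move=> /H[A [U [v [w [hA _ AS _ [vx _]]]]]].
apply: (@le_trans _ _ (v%:E + eps%:E)%E); first by rewrite -EFinD lee_fin -lerBlDr.
by apply: leeD2r; apply: le_trans (haar_measure_ge hA) (haar_measure_le AS).
Qed.

End Haar.

(** * The recursion for the irreducible locus *)

Section SlopeExponents.
Variable r : nat.

(** The ceiling of [m * (r - i) / r]: the least integer height on or above the line from [(0, m)] to
    [(r, 0)] at abscissa [i]. *)
Definition slope_exp m i := ((m * (r - i) + r.-1) %/ r)%N.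

Lemma slope_exp_leq m i t : (0 < r)%N -> (slope_exp m i <= t)%N = (m * (r - i) <= r * t)%N.
Proof.
move=> r0; rewrite -ltnS /slope_exp ltn_divLR // mulSnr [(r * t)%N]mulnC.
by move: (m * _)%N (t * r)%N => x y; lia.
Qed.

Lemma slope_exp0 m : (0 < r)%N -> slope_exp m 0 = m.
Proof.
move=> r0; apply/eqP; rewrite eqn_leq slope_exp_leq // subn0 mulnC leqnn /=.
by rewrite /slope_exp subn0 leq_divRL // leq_addr.
Qed.

Lemma sum_stretch_exp : ((\sum_(i < r) (r - i)).*2 = r * r.+1)%N.
Proof.
elim: r => [|n IH]; first by rewrite big_ord0.
rewrite big_ord_recl subn0 doubleD (eq_bigr (fun i : 'I_n => n - i)%N) ?IH //.
by rewrite -addnn; nia.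
Qed.

Hypothesis r_pr : prime r.

Lemma slope_exp_gt0 m (i : 'I_r) : (0 < m)%N -> (0 < slope_exp m i)%N.
Proof.
move=> m0; rewrite ltnNge slope_exp_leq ?prime_gt0 // muln0 leqn0 muln_eq0.
by rewrite negb_or -!lt0n m0 subn_gt0 ltn_ord.
Qed.

(** The exact heights at [i] and [r - i] add up to [m]. Neither is an integer, as the prime [r] does
    not divide [m * i], so rounding both up adds exactly 1. *)
Lemma slope_expD m i : (0 < m < r)%N -> (0 < i < r)%N ->
  (slope_exp m i + slope_exp m (r - i) = m.+1)%N.
Proof.
move=> mr ir; have r0 := prime_gt0 r_pr; have r1 := prime_gt1 r_pr.
have [k [s [E s0 sr]]] : exists k s, [/\ (m * i = k * r + s)%N, (0 < s)%N & (s < r)%N].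
  exists (m * i %/ r)%N, (m * i %% r)%N; rewrite -divn_eq ltn_mod r0; split=> //.
  by rewrite lt0n -/(dvdn r _) Euclid_dvdM // !gtnNdvd //; case/andP: ir; case/andP: mr.
have [m0 mr'] := andP mr; have [i0 ir'] := andP ir.
have km : (k < m)%N.
  rewrite -(ltn_pmul2r r0); apply: (@leq_ltn_trans (m * i)); first by rewrite E leq_addr.
  by rewrite ltn_pmul2l.
have div_add q t : (t < r)%N -> ((q * r + t) %/ r = q)%N.
  by move=> tr; rewrite divnMDl // divn_small // addn0.
have h1 : slope_exp m (r - i) = k.+1.
  rewrite /slope_exp subKn 1?ltnW // -[RHS](@div_add k.+1 s.-1); last by lia.
  by congr (_ %/ _)%N; rewrite E mulSn; move: (k * r)%N => x; lia.
have h2 : slope_exp m i = (m - k)%N.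
  rewrite /slope_exp -[RHS](@div_add (m - k)%N (r - s).-1); last by lia.
  congr (_ %/ _)%N; rewrite mulnBr mulnBl E.
  have : (k * r + r <= m * r)%N by rewrite -mulSnr leq_mul2r km orbT.
  by move: (k * r)%N (m * r)%N => x y; lia.
by rewrite h1 h2; lia.
Qed.

(** Pair [i] with [r - i] for [0 < i < r]; the index 0 alone contributes [m]. *)
Lemma sum_slope_exp m : (0 < m < r)%N ->
  ((\sum_(i < r) slope_exp m i).*2 + 2 = m.+1 * r.+1)%N.
Proof.
move=> mr; have r0 := prime_gt0 r_pr.
rewrite -(big_mkord xpredT) big_ltn // slope_exp0 //.
have -> : (m.+1 * r.+1 = (m.*2 + 2) + m.+1 * (r - 1))%N by nia.
rewrite doubleD addnAC; congr (_ + _)%N; rewrite -addnn {2}big_nat_rev /= -big_split /=.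
transitivity (\sum_(1 <= i < r) m.+1)%N; last by rewrite sum_nat_const_nat mulnC.
by apply: eq_big_nat => i ir; rewrite add1n subSS slope_expD.
Qed.

End SlopeExponents.

(** * The set equation satisfied by the irreducible locus *)

Section Recursion.
Variables (p r : nat).
Local Notation Zp := (padic_int p).
Local Notation b := (padic_base p).
Local Notation V := ('I_r -> Zp).
Local Notation red := (map_poly (@padic_residue p)).
Implicit Types (c d : V) (S : set V).

Definition box (e : 'I_r -> nat) c := forall i, pdvd (e i) (c i).

Definition translate (a : Zp) c : V := fun i => (monic_of c \Po ('X + a%:P))`_i.

Lemma monic_of_translate a c :
  monic_of (translate a c) = monic_of c \Po ('X + a%:P).
Proof.
have Xm : ('X + a%:P : {poly Zp}) \is monic by rewrite -[a]opprK rmorphN monicXsubC.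
have Xs : size (('X + a%:P) ^+ r : {poly Zp}) = r.+1.
  by have := size_exp_XsubC r (- a); rewrite rmorphN opprK.
set P := \poly_(j < r) oapp c 0 (insub j).
have sP : (size (P \Po ('X + a%:P)) <= r)%N.
  have [P0|P0] := eqVneq P 0; first by rewrite P0 comp_poly0 size_poly0.
  apply: leq_trans (size_comp_poly_leq _ _) _.
  rewrite -[a]opprK rmorphN size_XsubC /= muln1 prednK ?size_poly_gt0 //.
  exact: size_poly.
have E : monic_of c \Po ('X + a%:P) = ('X + a%:P) ^+ r + (P \Po ('X + a%:P)).
  by rewrite monic_of_poly comp_polyD comp_Xn_poly.
rewrite [RHS](@monic_of_coef p r) //; rewrite E.
  by rewrite monicE lead_coefDl ?Xs // -monicE monic_exp.
by rewrite size_polyDl Xs.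
Qed.

Lemma monic_of_inj c d : monic_of c = monic_of d -> c = d.
Proof. by move=> e; apply: funext => i; rewrite -!coef_monic_of e. Qed.

Lemma translateK a : cancel (translate a) (translate (- a)).
Proof.
move=> c; apply: monic_of_inj; rewrite !monic_of_translate rmorphN.
exact: comp_polyXaddC_K.
Qed.

Lemma translateNK a : cancel (translate (- a)) (translate a).
Proof. by move=> c; rewrite -{1}[a]opprK translateK. Qed.

Lemma agree_translate a k c d : agree k c d -> agree k (translate a c) (translate a d).
Proof.
move=> /agree_monic_of[P E]; apply/agree_monic_of; exists (P \Po ('X + a%:P)).
by rewrite !monic_of_translate E comp_polyD comp_polyZ.
Qed.

Lemma irreducible_translate a c :
  Zp_irreducible (monic_of (translate a c)) <-> Zp_irreducible (monic_of c).
Proof.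
split=> h; last by rewrite monic_of_translate; apply: comp_irreducible.
by rewrite -(translateK a c) monic_of_translate; apply: comp_irreducible.
Qed.

Lemma red_monic_of c : red (monic_of c) = 'X^r + red (\poly_(j < r) oapp c 0 (insub j)).
Proof. by rewrite monic_of_poly rmorphD /= map_polyXn. Qed.

Hypotheses (b_pr : prime b) (r_pr : prime r).

Let zero : 'I_r := Ordinal (prime_gt0 r_pr).

Lemma box1P c : box (fun=> 1%N) c <-> red (monic_of c) = 'X^r.
Proof.
rewrite red_monic_of; split=> [h|/eqP].
  rewrite (_ : red _ = 0) ?addr0 //; apply/polyP => j.
  rewrite coef_map coef_poly coef0; case: ltnP => jr /=; last exact: rmorph0.
  by rewrite insubT /=; apply/(padic_residue_eq0 b_pr).
rewrite -subr_eq0 addrAC subrr add0r => /eqP h i.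
have := congr1 (fun P : {poly _} => P`_i) h.
by rewrite coef_map coef_poly coef0 ltn_ord valK /= => /(padic_residue_eq0 b_pr).
Qed.

Lemma box1_translate (a : 'F_b) c :
  box (fun=> 1%N) (translate (padic_lift a) c) <-> red (monic_of c) = ('X - a%:P) ^+ r.
Proof.
rewrite box1P monic_of_translate map_comp_poly rmorphD /= map_polyX map_polyC /=.
rewrite padic_liftK; split=> [E|->].
  have := comp_polyXaddC_K (red (monic_of c)) a; rewrite E comp_Xn_poly => <-.
  by [].
by rewrite rmorphXn /= rmorphB /= comp_polyX comp_polyC addrK.
Qed.

(** Valuations are integers, so lying above the line amounts to exceeding the rounded heights;
    degrees [r] and beyond impose no condition. *)
Lemma box_wpoly m c : (0 < m)%N ->
  box (slope_exp r m) c <-> wpoly r m (r * m) (monic_of c).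
Proof.
move=> m0; have r0 := prime_gt0 r_pr; split=> [h j|h i].
  have [jr|rj] := ltnP j r; last by apply: wt_triv; rewrite mulnC leq_mul2l rj orbT.
  rewrite (coef_monic_of _ (Ordinal jr)); exists (slope_exp r m j); last exact: h (Ordinal jr).
  have := leqnn (slope_exp r m j); rewrite {1}slope_exp_leq //.
  by move: (slope_exp _ _ _) => t; nia.
have [t ht] := h i; rewrite coef_monic_of; apply: pdvd_le.
rewrite slope_exp_leq //; have := ltn_ord i; nia.
Qed.

(** The members of [E_m] with constant coefficient of valuation exactly [m]; for [m = 1] these are
    the Eisenstein polynomials. *)
Definition eisenstein m c := box (slope_exp r m) c /\ ~ pdvd m.+1 (c zero).

Definition rescaled S c := exists2 d, S d & forall i, c i = b%:R ^+ (r - i) * d i.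

Definition degenerate S c :=
  (exists2 m, m \in index_iota 1 r & eisenstein m c) \/ rescaled S c.

Definition residue_irr c := irreducible_poly (red (monic_of c)).

(** The right-hand side of the set equation, with [S] in place of the irreducible locus. *)
Definition refine S c := residue_irr c \/
  exists2 a : 'F_b, a \in enum 'F_b & degenerate S (translate (padic_lift a) c).

Lemma refine_mono S T : (forall c, S c -> T c) -> forall c, refine S c -> refine T c.
Proof.
move=> ST c [|[a aF [|[d Sd E]]]]; first by left.
  by right; exists a => //; left.
by right; exists a => //; right; exists d => //; exact: ST.
Qed.

Lemma degenerate_box1 S c : degenerate S c -> box (fun=> 1%N) c.
Proof.
move=> [[m + [h _]]|[d _ E]] i.
  rewrite mem_index_iota => /andP[m0 _]; apply: pdvd_le (h i).
  exact: slope_exp_gt0.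
by rewrite E; apply: pdvd_le (pdvd_expM _ _); rewrite subn_gt0.
Qed.

Lemma rescaled_stretch c d : (forall i, c i = b%:R ^+ (r - i) * d i) ->
  monic_of c = stretch r (monic_of d).
Proof.
move=> E; apply/polyP => j; have [jr|] := ltnP j r.
  by rewrite coef_stretch ?(ltnW jr) // !(coef_monic_of _ (Ordinal jr)) E.
rewrite leq_eqVlt => /orP[/eqP <-|rj]; last first.
  rewrite !nth_default ?size_monic_of //.
  by rewrite size_stretch ?monic_of_monic ?size_monic_of.
have lead1 (e : V) : (monic_of e)`_r = 1.
  by have := monicP (monic_of_monic e); rewrite lead_coefE size_monic_of.
by rewrite coef_stretch // subnn mul1r !lead1.
Qed.

Lemma irreducible_rescaled c d : (forall i, c i = b%:R ^+ (r - i) * d i) ->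
  Zp_irreducible (monic_of c) <-> Zp_irreducible (monic_of d).
Proof.
move=> /rescaled_stretch E; rewrite E; apply: stretch_irreducible => //.
- exact: monic_of_monic.
- exact: size_monic_of.
- rewrite -E; exact: monic_of_monic.
Qed.

Lemma eisenstein_irreducible m c : (0 < m < r)%N -> eisenstein m c ->
  Zp_irreducible (monic_of c).
Proof.
move=> mr [h nd]; have /andP[m0 _] := mr.
apply: (dumas_irreducible b_pr (monic_of_monic c) (size_monic_of c) r_pr mr).
  exact/box_wpoly.
by rewrite -[0%N]/(val zero) coef_monic_of.
Qed.

(** The single slope is fixed by the constant coefficient. If [b ^ r] divides it, all coefficients
    allow rescaling; otherwise its exact valuation [m] lies strictly between 0 and [r]. *)
Lemma irreducible_degenerate c : box (fun=> 1%N) c -> Zp_irreducible (monic_of c) ->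
  degenerate (fun d => Zp_irreducible (monic_of d)) c.
Proof.
move=> h irr; have r0 := prime_gt0 r_pr.
have slope m : (0 < m)%N -> pdvd m (c zero) -> box (slope_exp r m) c.
  move=> m0 cm; apply/box_wpoly => //.
  apply: (irreducible_one_slope b_pr (monic_of_monic c) (size_monic_of c) r0 irr).
  by rewrite -[0%N]/(val zero) coef_monic_of.
have [cr|ncr] := pselect (pdvd r (c zero)).
  right; have /choice[d dE] i : exists y, c i = b%:R ^+ (r - i) * y.
    have [y ->] := slope r r0 cr i; exists y.
    by rewrite /slope_exp mulnC divnMDl // divn_small ?addn0 // prednK.
  by exists d => //; apply/(irreducible_rescaled dE).
left; have ex : exists m, `[< pdvd m (c zero) >] by exists 1%N; apply/asboolP/h.
have bd m : `[< pdvd m (c zero) >] -> (m <= r)%N.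
  by move=> /asboolP cm; rewrite leqNgt; apply/negP => /ltnW /pdvd_le /(_ cm).
case: (ex_maxnP ex bd) => m /asboolP cm mmax; exists m.
  rewrite mem_index_iota mmax; last exact/asboolP/h.
  by rewrite ltn_neqAle bd ?andbT; [apply/eqP => mr; rewrite -mr in ncr|apply/asboolP].
split; first by apply: slope => //; apply: mmax; exact/asboolP/h.
by move=> /asboolP /mmax; rewrite ltnn.
Qed.

Lemma irreducible_refine c : Zp_irreducible (monic_of c) <->
  refine (fun d => Zp_irreducible (monic_of d)) c.
Proof.
split=> [irr|[h|[a _ h]]].
- have [|[a E]] := irreducible_residue_cases b_pr r_pr (monic_of_monic c) (size_monic_of c) irr.
    by left.
  right; exists a; first by rewrite mem_enum.
  apply: irreducible_degenerate; first exact/box1_translate.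
  exact/irreducible_translate.
- exact: (@residue_irreducible p b_pr _ (monic_of_monic c) h).
apply/(irreducible_translate (padic_lift a)).
have [[m]|[d irr E]] := h; last exact/(irreducible_rescaled E).
by rewrite mem_index_iota; apply: eisenstein_irreducible.
Qed.

(** The irreducible locus is a fixed point of the monotone operator [refine], so it stays between
    the iterates of the empty set and of the whole space. *)
Lemma refine_sandwich K c :
  (iter K refine (fun=> False) c -> Zp_irreducible (monic_of c)) /\
  (Zp_irreducible (monic_of c) -> iter K refine (fun=> True) c).
Proof.
elim: K c => [|K IH] c //=; split=> [|/irreducible_refine].
  by move=> /(refine_mono (fun d => (IH d).1)) /irreducible_refine.
exact: refine_mono (fun d => (IH d).2) c.
Qed.

End Recursion.

(** * The affine action of the set equation on volumes *)

Section RefineVolume.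
Variables (R : realType) (p r : nat).
Local Notation Zp := (padic_int p).
Local Notation b := (padic_base p).
Local Notation V := ('I_r -> Zp).
Implicit Types (S : set V) (v : R).
Hypotheses (b_pr : prime b) (r_pr : prime r).

Local Notation zero := (Ordinal (prime_gt0 r_pr)).
Local Notation slope_sum m := (\sum_(i < r) slope_exp r m i)%N.

(** This equals [(1 - 1 / b) * vol(E_m)]: raising the exponent of the constant coefficient by one
    divides the volume by [b]. *)
Definition eisenstein_volume m : R :=
  (b ^ slope_sum m)%:R^-1 - (b ^ (slope_sum m).+1)%:R^-1.

Definition refine_const : R :=
  #|irreducible_ffuns b r|%:R / (b ^ r)%:R
  + b%:R * \sum_(1 <= m < r) eisenstein_volume m.

Definition refine_factor : R := b%:R / (b ^ (\sum_(i < r) (r - i)))%:R.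

Lemma has_volume_box (e : 'I_r -> nat) : has_volume (@box p r e) ((b ^ (\sum_i e i))%:R^-1 : R).
Proof.
have := has_volume_scale e (has_volumeT R p r); rewrite mul1r.
apply: has_volume_ext => c; split=> [[a _ E] i|h].
  by rewrite E; apply: pdvd_expM.
by have [a E] := choice h; exists a.
Qed.

Lemma has_volume_eisenstein m : (0 < m < r)%N ->
  has_volume (eisenstein (p := p) r_pr m) (eisenstein_volume m).
Proof.
move=> /andP[m0 mr].
pose e' (i : 'I_r) := if i == zero then m.+1 else slope_exp r m i.
have sE : slope_exp r m zero = m by rewrite slope_exp0 // prime_gt0.
have ee' (i : 'I_r) : (slope_exp r m i <= e' i)%N.
  by rewrite /e'; case: eqP => // ->; rewrite sE.
have e'z : e' zero = m.+1 by rewrite /e' eqxx.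
have -> : eisenstein_volume m = (b ^ slope_sum m)%:R^-1 - (b ^ (\sum_i e' i))%:R^-1.
  rewrite /eisenstein_volume; congr (_ - (b ^ _)%:R^-1).
  rewrite (bigD1 zero) //= [RHS](bigD1 zero) //= e'z sE addSn.
  by congr (_ + _).+1; apply: eq_bigr => i /negPf i0; rewrite /e' i0.
apply: has_volume_ext (has_volumeD _ (has_volume_box _) (has_volume_box e')) => [c|c h i].
  split=> -[h nh]; split=> //.
    move=> cz; apply: nh => i; rewrite /e'; case: eqP => [->//|_]; exact: h.
  by move=> h'; apply: nh; have := h' zero; rewrite e'z.
by apply: pdvd_le (h i).
Qed.

(** The pieces are disjoint because the valuation of the constant coefficient tells them apart:
    exactly [m < r] in the Eisenstein pieces, at least [r] in the rescaled one. *)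
Lemma has_volume_degenerate S v : has_volume S v ->
  has_volume (degenerate r_pr S)
    (\sum_(1 <= m < r) eisenstein_volume m + v / (b ^ (\sum_(i < r) (r - i)))%:R).
Proof.
move=> hS; apply: has_volumeU.
- move=> c [m]; rewrite mem_index_iota => /andP[_ mr] [_ nd] [d _ E]; apply: nd.
  by rewrite E; apply: pdvd_le (pdvd_expM _ _); rewrite subn0.
- apply: has_volume_bigU => [|m|m m' c]; first exact: iota_uniq.
    by rewrite mem_index_iota; apply: has_volume_eisenstein.
  rewrite !mem_index_iota => /andP[m0 mr] /andP[m0' mr'] [h nh] [h' nh'].
  have r0 := prime_gt0 r_pr.
  have := h zero; have := h' zero; rewrite /= !slope_exp0 // => hm' hm.
  apply/eqP; rewrite eqn_leq; apply/andP; split; rewrite leqNgt; apply/negP => lt.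
    by apply: nh'; apply: pdvd_le hm.
  by apply: nh; apply: pdvd_le hm'.
exact: has_volume_scale.
Qed.

Lemma has_volume_residue_irr :
  has_volume (@residue_irr p r) (#|irreducible_ffuns b r|%:R / (b ^ r)%:R : R).
Proof.
have E : #|irreducible_ffuns b r|%:R / (b ^ r)%:R
    = \sum_(t <- enum (irreducible_ffuns b r)) ball_volume R p r 1.
  by rewrite big_enum sumr_const /ball_volume muln1 -[RHS]mulr_natl.
pose a (t : {ffun 'I_r -> 'F_b}) : V := fun i => padic_lift (t i).
have ballE t c : padic_ball (a t) 1 c <-> forall i, padic_residue (c i) = t i.
  split=> h i.
    by rewrite -[RHS]padic_liftK; apply/(padic_residue_eq b_pr)/pdigits_eq/h.
  by apply/pdigits_eq/(padic_residue_eq b_pr); rewrite h padic_liftK.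
have redE (c : V) : map_poly (@padic_residue p) (monic_of c)
    = ffun_poly [ffun i => padic_residue (c i)].
  have -> : [ffun i => padic_residue (c i)]
      = [ffun i : 'I_r => (map_poly (@padic_residue p) (monic_of c))`_i].
    by apply/ffunP => i; rewrite !ffunE coef_map coef_monic_of.
  apply: ffun_poly_coef; first by rewrite monic_map ?monic_of_monic.
  by rewrite size_red ?monic_of_monic // size_monic_of.
rewrite E; apply: has_volume_ext (has_volume_bigU (F := fun t => padic_ball (a t) 1) _ _ _).
- move=> c; rewrite /residue_irr redE; split=> [[t]|h].
    rewrite mem_enum finset.in_set => /asboolP ti /ballE ct.
    by rewrite (_ : finfun _ = t) //; apply/ffunP => i; rewrite ffunE.
  exists [ffun i => padic_residue (c i)].
    by rewrite mem_enum finset.in_set; apply/asboolP.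
  by apply/ballE => i; rewrite ffunE.
- exact: enum_uniq.
- by move=> t _; apply: has_volume_ball.
- move=> s t c _ _ /ballE hs /ballE ht; apply/ffunP => i.
  by rewrite -hs -ht.
Qed.

(** The pieces are separated by their reductions: the powers [('X - a%:P) ^+ r] differ for distinct
    [a], and none is irreducible since [r > 1]. *)
Lemma has_volume_refine S v : has_volume S v ->
  has_volume (refine r_pr S) (refine_const + refine_factor * v).
Proof.
move=> hS; have [r0 r1] := (prime_gt0 r_pr, prime_gt1 r_pr).
have -> : refine_const + refine_factor * v = #|irreducible_ffuns b r|%:R / (b ^ r)%:R
   + \sum_(a <- enum 'F_b) (\sum_(1 <= m < r) eisenstein_volume m
      + v / (b ^ (\sum_(i < r) (r - i)))%:R).
  rewrite big_enum /= sumr_const card_Fp // /refine_const /refine_factor.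
  by rewrite -[X in _ = _ + X]mulr_natl mulrDr -addrA mulrAC -mulrA [v / _]mulrC [_^-1 * v]mulrC.
have root_pow (a a' : 'F_b) : root (('X - a%:P) ^+ r) a' = (a' == a).
  by rewrite rootE !hornerE expf_eq0 r0 subr_eq0.
apply: has_volumeU; last 1 first.
- apply: has_volume_bigU => [|a _|a a' c _ _ /degenerate_box1 h /degenerate_box1 h'].
  + exact: enum_uniq.
  + apply: (has_volume_isometry (@agree_translate p r (padic_lift a))
      (@agree_translate p r (- padic_lift a))); first exact: translateK.
      exact: translateNK.
    exact: has_volume_degenerate.
  move: h h' => /(box1_translate b_pr) h /(box1_translate b_pr) h'.
  by have := root_pow a a; rewrite -h h' root_pow eqxx => /eqP.
- move=> c hirr [a _ /degenerate_box1 /(box1_translate b_pr) E].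
  have [_ /(_ ('X - a%:P))] := hirr; rewrite E size_XsubC => /(_ isT).
  rewrite -[r in _ ^+ r](prednK r0) exprS dvdp_mulIl => /(_ isT) /eqp_size.
  rewrite -exprS prednK // size_XsubC size_exp_XsubC => -[e].
  by move: r1; rewrite -e.
exact: has_volume_residue_irr.
Qed.

End RefineVolume.

(** * The density *)

Section IrreducibleDensity.
Variables (R : realType) (p r : nat).
Local Notation b := (padic_base p).
Hypotheses (b_pr : prime b) (r_pr : prime r).

Local Notation alpha := (refine_const R p r).
Local Notation beta := (refine_factor R p r).

Lemma refine_factor_ge0 : 0 <= beta.
Proof. by rewrite divr_ge0 ?ler0n. Qed.

Lemma refine_factor_le : beta <= 2^-1.
Proof.
have s3 : (2 <= \sum_(i < r) (r - i))%N.
  by have := sum_stretch_exp r; have := prime_gt1 r_pr; nia.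
rewrite /refine_factor ler_pdivrMr ?expb_gt0 // mulrC ler_pdivlMr ?ltr0n //.
rewrite -natrM ler_nat; apply: (@leq_trans (b ^ 2)).
  by rewrite expnS expn1 leq_mul2l prime_gt1 // orbT.
by rewrite leq_pexp2l // prime_gt0.
Qed.

Lemma refine_factor_neq1 : 1 - beta != 0.
Proof. by rewrite subr_eq0 gt_eqF //; apply: le_lt_trans refine_factor_le _; lra. Qed.

(** The affine map on volumes has fixed point [alpha / (1 - beta)], and each application multiplies
    the deviation from it by [beta]. *)
Lemma has_volume_iter_refine K (S : set ('I_r -> padic_int p)) (v : R) :
    has_volume S v ->
  has_volume (iter K (refine r_pr) S)
    (alpha / (1 - beta) + beta ^+ K * (v - alpha / (1 - beta))).
Proof.
move=> hS; elim: K => [|K IH] /=; first by rewrite mul1r addrC subrK.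
have := has_volume_refine b_pr r_pr IH; congr has_volume.
rewrite exprS mulrDr addrA -mulrA; congr (_ + _).
by field; exact: refine_factor_neq1.
Qed.

Lemma haar_irreducible :
  @haar_measure R p r [set c | Zp_irreducible (monic_of c)]%classic
    = (alpha / (1 - beta))%:E.
Proof.
set x := alpha / (1 - beta).
apply: haar_measure_sandwich (prime_gt0 r_pr) _ => eps eps0.
(* [C] bounds the initial deviations of both iterations, which start from volumes 0 and 1; as
   [beta <= 1/2], after [K] rounds they are at most [C / 2 ^ K <= eps]. *)
pose C : R := `|0 - x| + `|1 - x|.
pose K := Num.bound (C / eps).
have C0 : 0 <= C by rewrite addr_ge0 ?normr_ge0.
have small v : `|v - x| <= C -> `|beta ^+ K * (v - x)| <= eps.
  move=> vC; rewrite normrM ger0_norm ?exprn_ge0 ?refine_factor_ge0 //.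
  apply: (@le_trans _ _ (2^-1 ^+ K * C)).
    by apply: ler_pM => //; rewrite ?exprn_ge0 ?refine_factor_ge0 // lerXn2r ?nnegrE ?refine_factor_ge0 ?refine_factor_le.
  rewrite exprVn mulrC ler_pdivrMr ?exprn_gt0 // mulrC -ler_pdivrMr //.
  apply: ltW; apply: lt_trans (archi_boundP _) _; first by rewrite divr_ge0 // ltW.
  by rewrite -natrX ltr_nat ltn_expl.
exists (iter K (refine r_pr) (fun=> False)), (iter K (refine r_pr) (fun=> True)).
exists (x + beta ^+ K * (0 - x)), (x + beta ^+ K * (1 - x)); split.
- exact/has_volume_iter_refine/has_volume0.
- exact/has_volume_iter_refine/has_volumeT.
- by move=> c /(refine_sandwich b_pr r_pr K c).1.
- by move=> c /(refine_sandwich b_pr r_pr K c).2.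
split.
  rewrite lerD2l lerNl (le_trans _ (small 0 _)) //; first by rewrite -normrN ler_norm.
  by rewrite lerDl normr_ge0.
by rewrite lerD2l (le_trans (ler_norm _) (small 1 _)) // lerDr normr_ge0.
Qed.

(** With [q = b ^ (-(r + 1) / 2)], the Eisenstein volumes are [(b - 1) * q ^ (m + 1)]. Their
    geometric sum accounts for the second term of the numerator and for the common factor
    [1 - q]. *)
Lemma refine_density :
  alpha / (1 - beta) =
  (((b%:R : R) ^+ r - b%:R) * (1 - b%:R `^ (- (r%:R + 1) / 2))
     + r%:R * (b%:R - 1) * (1 - b%:R `^ (- ((r%:R + 1) * (r%:R - 1)) / 2)))
   / (r%:R * (b%:R : R) ^+ r
      * (1 - b%:R `^ (- (r%:R * (r%:R + 1)) / 2 + 1))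
      * (1 - b%:R `^ (- (r%:R + 1) / 2))).
Proof.
have [r0 r1] := (prime_gt0 r_pr, prime_gt1 r_pr).
set P : R := b%:R; set q := P `^ (- (r%:R + 1) / 2).
have P1 : 1 < P by rewrite ltr1n prime_gt1.
have P0 : P != 0 by rewrite gt_eqF // (lt_trans ltr01).
have Pge : 0 <= P by rewrite ler0n.
have powE s : ((b ^ s)%:R : R)^-1 = P `^ (- s%:R) by rewrite natrX powRN powR_mulrn.
have powD x y : P `^ (x + y) = P `^ x * P `^ y by rewrite powRD // P0 implybT.
have q_exp m : P `^ (- (r%:R + 1) / 2 * m%:R) = q ^+ m.
  by rewrite powRrM powR_mulrn // powR_ge0.
have eisE m : (0 < m < r)%N -> eisenstein_volume R p r m = (P - 1) * q ^+ m.+1.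
  move=> mr; rewrite /eisenstein_volume expnS natrM invfM powE.
  have -> : - ((\sum_(i < r) slope_exp r m i)%N)%:R = 1 + - (r%:R + 1) / 2 * m.+1%:R :> R.
    have /(congr1 (fun n => n%:R : R)) := sum_slope_exp r_pr mr.
    rewrite natrD natrM -muln2 natrM -[r.+1%:R]natr1 => e; lra.
  rewrite powD powRr1 // q_exp -/P.
  by rewrite -[X in X - _]mul1r -mulrBl mulrA mulrBl mul1r mulVf.
(* For [r = 2] the exponent of [q] is a half-integer; its square is an integral power of [b], which
   lets the final identity be checked by field arithmetic. *)
have q2 : q ^+ 2 = (P * P ^+ r)^-1.
  rewrite -q_exp divfK ?pnatr_eq0 // -exprS -natrX powE; congr (_ `^ _).
  by rewrite -natr1.
have q_neq1 : 1 - q != 0.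
  rewrite subr_eq0; apply/eqP => q1; move: q2; rewrite -q1 expr1n -exprS => /esym /eqP.
  by rewrite invr_eq1 gt_eqF // exprn_egt1.
have betaE : P `^ (- (r%:R * (r%:R + 1)) / 2 + 1) = beta.
  rewrite addrC powD powRr1 // /refine_factor powE; congr (_ * _ `^ _).
  have /(congr1 (fun n => n%:R : R)) := sum_stretch_exp r.
  rewrite natrM -muln2 natrM -[r.+1%:R]natr1 => e; lra.
pose G := \sum_(i < r.-1) q ^+ i.
have GE : 1 - P `^ (- ((r%:R + 1) * (r%:R - 1)) / 2) = (1 - q) * G.
  have -> : - ((r%:R + 1) * (r%:R - 1)) / 2 = - (r%:R + 1) / 2 * r.-1%:R :> R.
    by rewrite -[in RHS]subn1 natrB //; field.
  by rewrite q_exp -opprB subrX1 -mulNr opprB.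
have sumE : \sum_(1 <= m < r) eisenstein_volume R p r m = (P - 1) * (P * P ^+ r)^-1 * G.
  rewrite (eq_big_nat _ _ eisE) big_add1 big_mkord -q2 /G mulr_sumr.
  by apply: eq_bigr => i _; rewrite -mulrA -exprD add2n.
have cE : #|irreducible_ffuns b r|%:R = (P ^+ r - P) / r%:R.
  have /(congr1 (fun n => n%:R : R)) := card_irreducible_ffuns b_pr r_pr.
  rewrite natrM natrB; last by rewrite -{1}(expn1 b) leq_pexp2l // prime_gt0.
  by move=> e; rewrite -natrX -e mulfK // pnatr_eq0 -lt0n.
rewrite betaE GE /refine_const sumE cE natrX -/P.
have Pr0 : P ^+ r != 0 by rewrite expf_neq0.
have rR0 : r%:R != 0 :> R by rewrite pnatr_eq0 -lt0n.
move: refine_factor_neq1; move: (P ^+ r) Pr0 (beta) => Y Y0 F F1.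
by field; rewrite F1 q_neq1 rR0 P0 Y0.
Qed.

End IrreducibleDensity.

Theorem theorem6 (R : realType) (p r : nat) :
  prime r -> prime p -> p != r ->
  @haar_measure R p r [set c | Zp_irreducible (monic_of c)] =
  ((((p%:R : R) ^+ r - p%:R) * (1 - p%:R `^ (- (r%:R + 1) / 2))
     + r%:R * (p%:R - 1) * (1 - p%:R `^ (- ((r%:R + 1) * (r%:R - 1)) / 2)))
   / (r%:R * (p%:R : R) ^+ r
      * (1 - p%:R `^ (- (r%:R * (r%:R + 1)) / 2 + 1))
      * (1 - p%:R `^ (- (r%:R + 1) / 2))))%:E.
Proof.
move=> r_pr p_pr _; have bE := padic_base_prime p_pr.
have b_pr : prime (padic_base p) by rewrite bE.
by rewrite haar_irreducible // refine_density // bE.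
Qed.
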